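(* Let $\Delta$, $H$, $K$, $K_1$, $K_2$ be as in the context, let $x_1=K_1$, $x_2=K_2$ (adjacent vertices with $|\Delta(x_1)|=4$, $|\Delta(x_2)|=3$), and let $W_i=O_3(H_{x_i}^{[1]})$, $\hat W_i=O_3(K_{x_i}^{[1]})$ for $i\in\{1,2\}$. Then $W_1$ is elementary abelian of order $9$, $W_2$ is a special group of order $27$ and exponent $3$, $\hat W_1\cong W_1\times C_3$ and $\hat W_2\cong W_2\times C_3$. Moreover: (i) $H_{x_1}^{\Delta(x_1)}\cong{\rm Sym}(4)$, $H_{x_1}^{[1]}\cong W_1\rtimes C_2$, $H_{x_1}^{[2]}\cong W_1$, $H_{x_1}^{[3]}=1$; (ii) $H_{x_2}^{\Delta(x_2)}\cong{\rm Sym}(3)$, $H_{x_2}^{[1]}\cong W_2\rtimes C_2$, $H_{x_2}^{[2]}=H_{x_2}^{[3]}=Z(W_2)\cong C_3$, $H_{x_2}^{[4]}=1$; (iii) $K_{x_1}^{\Delta(x_1)}\cong{\rm Sym}(4)$, $K_{x_1}^{[1]}\cong\hat W_1\rtimes C_2$, $K_{x_1}^{[2]}\cong\hat W_1$, $K_{x_1}^{[3]}=K_{x_1}^{[4]}=Z(K_{x_1})\cong C_3$, $K_{x_1}^{[5]}=1$; (iv) $K_{x_2}^{\Delta(x_2)}\cong{\rm Sym}(3)$, $K_{x_2}^{[1]}\cong\hat W_2\rtimes C_2$, $K_{x_2}^{[2]}=K_{x_2}^{[3]}=Z(\hat W_2)\cong C_3\times C_3$, $K_{x_2}^{[4]}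=1$.
   Context: Construction. Let $\mathbb F_{64}$ be the field with $64$ elements, $\zeta$ a generator of $\mathbb F_{64}^*$, $\rho:x\mapsto x^2$ and $\tau=\rho^3$. On $\mathbb F_{64}^3$ with standard basis $e_1,e_2,e_3$ take the Hermitian form $(x,y)=\sum_i x_iy_i^\tau$, with groups ${\rm SU}_3(8)\le\Gamma{\rm U}_3(8)$. For $X\in\Gamma{\rm U}_3(8)$ let $\overline X$ be its image in ${\rm P\Gamma U}_3(8)=\Gamma{\rm U}_3(8)/\{\text{scalars}\}$. Let $\sigma$ be the semilinear map $\sum a_ie_i\mapsto\sum a_i^\rho e_i$. Let $\beta=\zeta^7$, $a=\beta^3$. Define $A=\begin{pmatrix}0&0&1\\1&0&0\\0&1&0\end{pmatrix}$, $B={\rm diag}(1,a,a^{-1})$, $C={\rm diag}(\beta,\beta^4,\beta^4)$, $D=\begin{pmatrix}1&1&1\\1&a&a^{-1}\\1&a^{-1}&a\end{pmatrix}$, $E={\rm diag}(1,\beta,\beta^{-1})$, $F=\begin{pmatrix}1&0&0\\0&0&1\\0&1&0\end{pmatrix}$. Put $H_1=\langle\overline A,\overline B,\overline C,\overline D,\overline\sigma^3\rangle$, $H_2=\langle\overline A,\overline B,\overline C,\overline E,\overline F,\overline\sigma^3\rangle$, $H=\langle H_1,H_2\rangle$, $K_1=\langle H_1,\overline\sigma^2\rangle$, $K_2=\langle H_2,\overline\sigma^2\rangle$, $K=\langle K_1,K_2\rangle$. $\Delta$ is the coset graph with vertices the right cosets $K_1g$, $K_2g$ ($g\in K$), $K_1g\sim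 K_2h$ iff $K_1g\cap K_2h\ne\emptyset$; $K$ and $H$ act by right multiplication. Notation. For a group $G$ acting on $\Delta$ and a vertex $z$: $\Delta(z)$ is the neighbourhood of $z$, $G_z^{[i]}$ is the kernel of the action of $G_z$ on the vertices at distance $\le i$ from $z$, and $G_z^{\Delta(z)}\cong G_z/G_z^{[1]}$ is the permutation group induced by $G_z$ on $\Delta(z)$. *)

(* Defs.v *)
From HB Require Import structures.
From mathcomp Require Import all_boot all_order all_algebra all_fingroup.
From mathcomp Require Import all_solvable all_field ring.

Set Implicit Arguments.
Unset Strict Implicit.
Unset Printing Implicit Defensive.

Import GRing.Theory.

Local Open Scope ring_scope.

Section PGammaU.

Variable F : finFieldType.

Definition rho (x : F) : F := x ^+ 2.
Definition tau : F -> F := iter 3 rho.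

Definition herm (u v : 'rV[F]_3) : F := \sum_i u 0 i * tau (v 0 i).

Definition field_aut : {set {perm F}} :=
  [set s : {perm F} |
    [forall x, forall y, (s (x + y) == s x + s y) && (s (x * y) == s x * s y)]].

(* GU_3 extended by field automorphisms: the semilinear s-isometries, for s
   ranging over Aut F. Maps act on row vectors on the right, in accordance with
   the product of {perm _}, for which (g * h) v = h (g v). *)
Definition GammaU : {set {perm 'rV[F]_3}} :=
  [set g : {perm 'rV[F]_3} | [exists (s | s \in field_aut),
    [forall c, forall u, forall v,
      (g (c *: u + v) == s c *: g u + g v)
      && (herm (g u) (g v) == s (herm u v))]]].

Definition scalars : {set {perm 'rV[F]_3}} :=
  [set g in GammaU | [exists c, [forall v, g v == c *: v]]].

Lemma GammaUP (g : {perm 'rV[F]_3}) :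
  reflect (exists2 s : {perm F}, s \in field_aut &
             forall c u v, g (c *: u + v) = s c *: g u + g v
                        /\ herm (g u) (g v) = s (herm u v))
          (g \in GammaU).
Proof.
rewrite inE; apply: (iffP exists_inP) => -[s sA gs]; exists s => //.
  move=> c u v; move/forallP/(_ c)/forallP/(_ u)/forallP/(_ v): gs.
  by case/andP=> /eqP-> /eqP->.
apply/forallP=> c; apply/forallP=> u; apply/forallP=> v.
by have [-> ->] := gs c u v; rewrite !eqxx.
Qed.

Lemma field_autP (s : {perm F}) :
  reflect (forall x y, s (x + y) = s x + s y /\ s (x * y) = s x * s y)
          (s \in field_aut).
Proof.
rewrite inE; apply: (iffP forallP) => sA x.
  by move=> y; move/forallP/(_ y): (sA x) => /andP[/eqP-> /eqP->].
by apply/forallP=> y; have [-> ->] := sA x y; rewrite !eqxx.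
Qed.

Lemma GammaU_group_set : group_set GammaU.
Proof.
apply/group_setP; split=> [|g h /GammaUP[s sA gs] /GammaUP[t tA ht]].
  apply/GammaUP; exists 1%g; first by apply/field_autP=> x y; rewrite !perm1.
  by move=> c u v; rewrite !perm1.
apply/GammaUP; exists (s * t)%g => [|c u v].
  apply/field_autP=> x y; rewrite !permM.
  have [-> ->] := field_autP _ sA x y.
  by have [-> _] := field_autP _ tA (s x) (s y);
     have [_ ->] := field_autP _ tA (s x) (s y).
rewrite !permM; have [-> e1] := gs c u v; have [-> e2] := ht (s c) (g u) (g v).
by rewrite e2 e1.
Qed.
Canonical GammaU_group := Group GammaU_group_set.

Lemma scalarsP (g : {perm 'rV[F]_3}) :
  reflect (g \in GammaU /\ exists c, forall v, g v = c *: v) (g \in scalars).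
Proof.
apply: (iffP setIdP) => -[gG]; last first.
  by case=> c gc; split=> //; apply/existsP; exists c; apply/forallP=> v; rewrite gc.
by case/existsP=> c /forallP gc; split=> //; exists c => v; apply/eqP.
Qed.

Lemma scalars_group_set : group_set scalars.
Proof.
apply/group_setP; split=> [|g h /scalarsP[gG [c gc]] /scalarsP[hG [d hd]]].
  by apply/scalarsP; split=> //; exists 1 => v; rewrite perm1 scale1r.
apply/scalarsP; split; first exact: groupM.
by exists (d * c) => v; rewrite permM hd gc scalerA.
Qed.
Canonical scalars_group := Group scalars_group_set.

(* The permutation with underlying function f; the value 1 on non-injective f
   is never used, by the lemmas [genU] and [sigmaU] below. *)
Definition perm_fun (f : 'rV[F]_3 -> 'rV[F]_3) : {perm 'rV[F]_3} :=
  insubd (1%g : {perm 'rV[F]_3}) (finfun f).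

Lemma perm_funE (f : 'rV[F]_3 -> 'rV[F]_3) : injective f -> perm_fun f =1 f.
Proof.
move=> fI v; rewrite -pvalE /perm_fun insubdK ?ffunE //.
by apply/injectiveP=> x y; rewrite !ffunE => /fI.
Qed.

Definition linmap (M : 'M[F]_3) : {perm 'rV[F]_3} := perm_fun (fun v => v *m M).

Definition sigma : {perm 'rV[F]_3} := perm_fun (map_mx rho).

(* The image of X in PGammaU_3(8) = (GammaU / scalars)%g. *)
Definition bar (X : {perm 'rV[F]_3}) : coset_of scalars := coset scalars X.

Definition mx3 (s : seq (seq F)) : 'M[F]_3 :=
  \matrix_(i < 3, j < 3) (nth [::] s i)`_j.

Definition diag3 (x y z : F) : 'M[F]_3 :=
  mx3 [:: [:: x; 0; 0]; [:: 0; y; 0]; [:: 0; 0; z]].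

Section Generators.

Variable zeta : {unit F}.

Definition beta : F := FinRing.uval zeta ^+ 7.
Definition a_ : F := beta ^+ 3.

Definition matA : 'M[F]_3 := mx3 [:: [:: 0; 0; 1]; [:: 1; 0; 0]; [:: 0; 1; 0]].
Definition matB : 'M[F]_3 := diag3 1 a_ a_^-1.
Definition matC : 'M[F]_3 := diag3 beta (beta ^+ 4) (beta ^+ 4).
Definition matD : 'M[F]_3 :=
  mx3 [:: [:: 1; 1; 1]; [:: 1; a_; a_^-1]; [:: 1; a_^-1; a_]].
Definition matE : 'M[F]_3 := diag3 1 beta beta^-1.
Definition matF : 'M[F]_3 := mx3 [:: [:: 1; 0; 0]; [:: 0; 0; 1]; [:: 0; 1; 0]].

Definition grpH1 : {group coset_of scalars} :=
  <<[set bar (linmap matA); bar (linmap matB); bar (linmap matC);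
         bar (linmap matD); (bar sigma ^+ 3)%g]>>%G.

Definition grpH2 : {group coset_of scalars} :=
  <<[set bar (linmap matA); bar (linmap matB); bar (linmap matC);
         bar (linmap matE); bar (linmap matF); (bar sigma ^+ 3)%g]>>%G.

Definition grpH : {group coset_of scalars} := <<grpH1 :|: grpH2>>%G.

Definition grpK1 : {group coset_of scalars} := <<grpH1 :|: [set (bar sigma ^+ 2)%g]>>%G.

Definition grpK2 : {group coset_of scalars} := <<grpH2 :|: [set (bar sigma ^+ 2)%g]>>%G.

Definition grpK : {group coset_of scalars} := <<grpK1 :|: grpK2>>%G.

End Generators.

Definition unitary (M : 'M[F]_3) : Prop := M *m (map_mx tau M)^T = 1%:M.

Hypothesis cardF : #|F| = 64.

Lemma two0 : 2%:R = 0 :> F.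
Proof.
have := expf_card (-1 : F); rewrite cardF -signr_odd /= expr0 => e.
by apply/eqP; rewrite -[2%N]/(1 + 1)%N natrD {2}e addrC addNr.
Qed.

Lemma rhoD : {morph rho : x y / x + y}.
Proof. by move=> x y; rewrite /rho sqrrD -mulr_natr two0 mulr0 addr0. Qed.

Lemma rhoM : {morph rho : x y / x * y}.
Proof. by move=> x y; rewrite /rho exprMn. Qed.

Lemma rho0 : rho 0 = 0. Proof. by rewrite /rho expr0n. Qed.

Lemma rho_inj : injective rho.
Proof.
move=> x y rxy; have: (x - y) ^+ 2 == 0.
  by rewrite -[_ ^+ 2]/(rho _) rhoD rxy -rhoD subrr rho0.
by rewrite expf_eq0 /= subr_eq0 => /eqP.
Qed.

Lemma tauE x : tau x = x ^+ 8.
Proof. by rewrite /tau /= /rho -!exprM. Qed.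

Lemma tauD : {morph tau : x y / x + y}.
Proof. by move=> x y; rewrite /tau /= !rhoD. Qed.

Lemma tauM : {morph tau : x y / x * y}.
Proof. by move=> x y; rewrite /tau /= !rhoM. Qed.

Lemma tau0 : tau 0 = 0. Proof. by rewrite /tau /= !rho0. Qed.

Lemma tau_sum (I : finType) (f : I -> F) : tau (\sum_i f i) = \sum_i tau (f i).
Proof. by apply: (big_morph tau tauD tau0). Qed.

Lemma hermE u v : herm u v = (u *m (map_mx tau v)^T) 0 0.
Proof. by rewrite mxE; apply: eq_bigr => i _; rewrite !mxE. Qed.

Lemma linmapU M : unitary M -> linmap M =1 mulmx^~ M /\ linmap M \in GammaU.
Proof.
move=> uM; have lE : linmap M =1 mulmx^~ M.
  apply: perm_funE => u v /(congr1 (mulmx^~ (map_mx tau M)^T)).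
  by rewrite -!mulmxA uM !mulmx1.
split=> //; apply/GammaUP; exists 1%g.
  by apply/field_autP=> x y; rewrite !perm1.
move=> c u v; rewrite !lE !perm1 mulmxDl -scalemxAl; split=> //.
rewrite !hermE.
have ->: map_mx tau (v *m M) = map_mx tau v *m map_mx tau M.
  apply/matrixP=> i j; rewrite !mxE tau_sum; apply: eq_bigr => k _.
  by rewrite !mxE tauM.
by rewrite trmx_mul mulmxA -(mulmxA u) uM mulmx1.
Qed.

Lemma sigmaU : sigma =1 map_mx rho /\ sigma \in GammaU.
Proof.
have sE : sigma =1 map_mx rho.
  apply: perm_funE => u v uv; apply/matrixP=> i j; apply: rho_inj.
  by move/matrixP/(_ i j): uv; rewrite !mxE.
split=> //; apply/GammaUP; exists (perm rho_inj).
  by apply/field_autP=> x y; rewrite !permE rhoD rhoM.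
move=> c u v; rewrite !sE permE; split.
  by apply/matrixP=> i j; rewrite !mxE rhoD rhoM.
rewrite permE /herm (big_morph rho rhoD rho0); apply: eq_bigr => i _.
by rewrite !mxE rhoM /tau.
Qed.

Lemma scalars_normal : (scalars <| GammaU)%g.
Proof.
apply/andP; split; first by apply/subsetP=> g /scalarsP[].
apply/normsP=> h hG; apply/setP=> g; rewrite mem_conjg.
have genJ k x : k \in GammaU -> x \in scalars -> (x ^ k)%g \in scalars.
  move=> kG /scalarsP[xG [c xc]]; have [s sA ks] := GammaUP _ kG.
  apply/scalarsP; split; first exact: groupJ.
  have k0 : k 0 = 0.
    have [e _] := ks 1 0 0; move: e; rewrite scaler0 addr0.
    have s1 : s 1 = 1.
      have [_ e1] := field_autP _ sA 1 1; have [e0 _] := field_autP _ sA 0 0.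
      have s0 : s 0 = 0 by apply: (addrI (s 0)); rewrite -e0 !addr0.
      have n1 : s 1 != 0 by rewrite -s0 (inj_eq perm_inj) oner_eq0.
      by apply: (mulfI n1); rewrite -e1 !mulr1.
    by rewrite s1 scale1r => e; apply: (addrI (k 0)); rewrite -e addr0.
  exists (s c) => v; rewrite /conjg !permM xc.
  by have [+ _] := ks c (k^-1 v)%g 0; rewrite !addr0 k0 addr0 permKV => ->.
apply/idP/idP=> [/(genJ h _ hG)|/(genJ _ _ (groupVr hG)) //].
by rewrite conjgKV.
Qed.

Variable zeta : {unit F}.
Hypothesis gen_zeta : generator [set: {unit F}] zeta.

Lemma beta9 : beta zeta ^+ 9 = 1.
Proof.
have z0 : FinRing.uval zeta != 0 by rewrite -unitfE (valP zeta).
have f64 := expf_card (FinRing.uval zeta).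
apply: (mulIf z0); rewrite mul1r /beta -exprM -exprSr.
by rewrite -[X in _ ^+ X]cardF.
Qed.

Lemma a_neq1 : a_ zeta != 1.
Proof.
have oz : #[zeta]%g = 63.
  by rewrite orderE -(eqP gen_zeta) card_finField_unit cardF.
apply/negP=> /eqP; rewrite /a_ /beta -!exprM => z21.
have: (#[zeta]%g %| 21)%N.
  by rewrite order_dvdn; apply/eqP/val_inj; rewrite FinRing.val_unitX.
by rewrite oz.
Qed.

Lemma mx3_unitary (r0 r1 r2 : F * F * F) :
  let d (x y : F * F * F) :=
    x.1.1 * y.1.1 ^+ 8 + x.1.2 * y.1.2 ^+ 8 + x.2 * y.2 ^+ 8 in
  let s (x : F * F * F) := [:: x.1.1; x.1.2; x.2] in
  [/\ d r0 r0 = 1, d r0 r1 = 0 & d r0 r2 = 0] ->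
  [/\ d r1 r0 = 0, d r1 r1 = 1 & d r1 r2 = 0] ->
  [/\ d r2 r0 = 0, d r2 r1 = 0 & d r2 r2 = 1] ->
  unitary (mx3 [:: s r0; s r1; s r2]).
Proof.
move=> d s [e00 e01 e02] [e10 e11 e12] [e20 e21 e22].
apply/matrixP=> i j; rewrite !mxE !big_ord_recl big_ord0 !mxE !tauE addr0 addrA.
case: i => [[|[|[|//]]] pi]; case: j => [[|[|[|//]]] pj]; rewrite -val_eqE //=.
Qed.

Lemma genU M : M \in [:: matA; matB zeta; matC zeta; matD zeta; matE zeta; matF] ->
  linmap M =1 mulmx^~ M /\ linmap M \in GammaU.
Proof.
move=> MI; apply: linmapU; move: MI.
have b9 := beta9; have a1 := a_neq1.
have b0 : beta zeta != 0.
  by apply/eqP=> b0; move: b9; rewrite b0 expr0n /= => /eqP; rewrite eq_sym oner_eq0.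
have bN : (beta zeta)^-1 = beta zeta ^+ 8.
  by apply: (mulfI b0); rewrite divff // -exprS b9.
have a3 : a_ zeta ^+ 3 = 1 by rewrite /a_ -exprM.
have aN : (a_ zeta)^-1 = a_ zeta ^+ 2.
  have a0 : a_ zeta != 0 by rewrite /a_ expf_neq0.
  by apply: (mulfI a0); rewrite divff // -exprS a3.
have aa : a_ zeta ^+ 2 = - 1 - a_ zeta.
  have na : a_ zeta - 1 != 0 by rewrite subr_eq0.
  by apply: (mulfI na); ring: a3.
have t0 := two0.
rewrite !inE /matB /matC /matD /matE /diag3 aN bN.
move: (a_ zeta) (beta zeta) a3 aa b9 => a b a3 aa b9.
by do 5?[case/orP] => /eqP->;
  [ apply: (@mx3_unitary (0, 0, 1) (1, 0, 0) (0, 1, 0))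
  | apply: (@mx3_unitary (1, 0, 0) (0, a, 0) (0, 0, a ^+ 2))
  | apply: (@mx3_unitary (b, 0, 0) (0, b ^+ 4, 0) (0, 0, b ^+ 4))
  | apply: (@mx3_unitary (1, 1, 1) (1, a, a ^+ 2) (1, a ^+ 2, a))
  | apply: (@mx3_unitary (1, 0, 0) (0, b, 0) (0, 0, b ^+ 8))
  | apply: (@mx3_unitary (1, 0, 0) (0, 0, 1) (0, 1, 0))];
  split=> /=; (ring: b9 || ring: aa || (rewrite -[RHS]addr0 -t0; ring: aa)).
Qed.

End PGammaU.

Section CosetGraph.

Variable gT : finGroupType.

(* The vertices are the cosets incident to an edge: each coset of one of the
   two groups meets some coset of the other. *)
Definition coset_adj (K K1 K2 : {group gT}) : rel {set gT} :=
  [rel u v | [|| (u \in rcosets K1 K) && (v \in rcosets K2 K)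
               | (u \in rcosets K2 K) && (v \in rcosets K1 K)]
             && (u :&: v != set0)].

Variable e : rel {set gT}.

Definition nbhd (z : {set gT}) : {set {set gT}} := [set u | e z u].

Definition ball (z : {set gT}) (i : nat) : {set {set gT}} :=
  [set u | [exists n : 'I_i.+1, exists p : n.-tuple {set gT},
              path e z p && (last z p == u)]].

Definition vstab (G : {group gT}) (z : {set gT}) : {group gT} :=
  'C_G[z | 'Rs]%G.

Definition vker (G : {group gT}) (z : {set gT}) (i : nat) : {group gT} :=
  'C_(vstab G z)(ball z i | 'Rs)%G.

Definition nbhd_perms (G : {group gT}) (z : {set gT}) : {group {perm {set gT}}} :=
  (restr_perm (nbhd z) @* (actperm 'Rs @* vstab G z))%G.

End CosetGraph.

Definition isog_sdprod (gT aT bT : finGroupType)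
    (G : {set gT}) (A : {set aT}) (B : {set bT}) : Prop :=
  exists N C : {group gT}, [/\ N \isog A, C \isog B & N ><| C = G]%g.

(* Main.v *)
Require Import Defs.
From mathcomp Require Import all_boot all_order all_algebra all_fingroup.
From mathcomp Require Import all_solvable all_field ring.

(* Write T for K1 :&: K2. The kernels on the balls around x1 and x2 are obtained
   from each other by taking cores: the kernel on the ball of radius i + 1 around
   x1 is the intersection of the K1-conjugates of the kernel on the ball of radius
   i around x2 (intersected with K1), and symmetrically; kernels in H are the
   intersections with H of those in K. So only the amalgam K1 > T < K2 matters.

   Modulo scalars, K2 consists of monomial semilinear maps whose nonzero entries
   are powers of beta, and T of those with entries powers of a = beta ^+ 3; they are
   encoded by small tuples on which all verifications are finite computations. The
   only other generator is D: it satisfies D^2 = F, it conjugates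
   U = <A, B, F, sigma> into itself by explicit formulas, and D C D = C^-1 D C^-1.
   Hence K1 = T \cup T D T with T :&: T ^ D = U of index 3 in T, so |K1 : T| = 4.
   Finally, an element of K2 lies in H exactly when its field automorphism fixes
   beta + beta^-1, which generates F_8. *)

Set Implicit Arguments.
Unset Strict Implicit.
Unset Printing Implicit Defensive.

Import GRing.Theory.

Local Open Scope group_scope.

(** * Coset graphs of amalgams *)

(** The relations for [D] are those of the Weil representation of SL_2(3). Index coordinates by Z/3:
    [A] is a shift and [B] a modulation, commuting modulo scalars; [D] is the discrete Fourier
    transform, which exchanges them up to inversion and squares to [F], the map i -> -i; [C] is, up
    to a scalar, the quadratic phase diag(a^(i^2)), and the formula for D C D is a braid relation.
    Thus W_1 = <A, B>, the four neighbours of x_1 correspond to its four subgroups of order 3, and T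
    is the stabiliser of <B> in K1. The obstacle is that [D] is not monomial and has no code: it
    enters through its relations only, and conjugation by [D] can be computed only inside U. The
    groups Sym(4) and Sym(3) come from orders alone: 1296 = 24 * 54 and 972 = 6 * 162 for K, 432 =
    24 * 18 and 324 = 6 * 54 for H. All direct factors C_3 that separate K from H are generated by
    sigma^2, which fixes F_4 and so commutes with matrices over F_4. *)

Section SymmetricGroup.

Variables (T : finType) (n : nat) (f : 'I_n -> T).
Hypothesis f_inj : injective f.

Definition extend_ord_fun (s : 'S_n) (x : T) : T :=
  if [pick i | f i == x] is Some i then f (s i) else x.

Lemma extend_ord_fun_img s i : extend_ord_fun s (f i) = f (s i).
Proof.
rewrite /extend_ord_fun; case: pickP => [j /eqP/f_inj-> // | /(_ i)].
by rewrite eqxx.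
Qed.

Lemma extend_ord_fun_out s x : x \notin codom f -> extend_ord_fun s x = x.
Proof.
rewrite /extend_ord_fun => nfx; case: pickP => // j /eqP fj.
by rewrite -fj codom_f in nfx.
Qed.

Lemma extend_ord_fun_comp s t x :
  extend_ord_fun t (extend_ord_fun s x) = extend_ord_fun (s * t) x.
Proof.
have [/codomP[i ->]|nfx] := boolP (x \in codom f).
  by rewrite !extend_ord_fun_img permM.
by rewrite !extend_ord_fun_out.
Qed.

Lemma extend_ord_fun1 x : extend_ord_fun 1 x = x.
Proof.
have [/codomP[i ->]|nfx] := boolP (x \in codom f).
  by rewrite extend_ord_fun_img perm1.
by rewrite extend_ord_fun_out.
Qed.

Lemma extend_ord_fun_inj s : injective (extend_ord_fun s).
Proof.
apply: (can_inj (g := extend_ord_fun s^-1)) => x.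
by rewrite extend_ord_fun_comp mulgV extend_ord_fun1.
Qed.

Definition extend_ord_perm (s : 'S_n) : {perm T} := perm (@extend_ord_fun_inj s).

Lemma extend_ord_permM :
  {in [set: 'S_n] &, {morph extend_ord_perm : s t / s * t}}.
Proof.
by move=> s t _ _; apply/permP=> x; rewrite permM !permE extend_ord_fun_comp.
Qed.
Canonical extend_ord_perm_morphism := Morphism extend_ord_permM.

(** Extension by the identity off the image of [f] is an injective morphism from ['S_n]; since both
    groups have order n!, it is onto. *)
Lemma Sym_codom_isog : perm.Sym [set x in codom f] \isog [set: 'S_n].
Proof.
have injE : 'injm extend_ord_perm_morphism.
  apply/injmP=> s t _ _ est; apply/permP=> i; apply: f_inj.
  by rewrite -!extend_ord_fun_img; move/permP/(_ (f i)): est; rewrite !permE.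
rewrite isog_sym; apply/isogP; exists extend_ord_perm_morphism => //.
apply/eqP; rewrite eqEcard card_injm // cardsT card_Sn.
rewrite perm.card_Sym cardsE card_codom // card_ord leqnn andbT.
apply/subsetP=> _ /morphimP[s _ _ ->]; rewrite inE; apply/subsetP=> x.
rewrite !inE permE; apply: contraR => nfx; apply/eqP.
exact: extend_ord_fun_out.
Qed.

End SymmetricGroup.

Lemma Sym_isog (T : finType) (S : {set T}) : perm.Sym S \isog [set: 'S_(#|S|)].
Proof.
have := Sym_codom_isog (@enum_val_inj T (mem S)).
suff -> : [set x in codom (@enum_val T (mem S))] = S by [].
apply/setP=> x; rewrite inE; apply/codomP/idP=> [[i ->]|Sx]; first exact: enum_valP.
by exists (enum_rank_in Sx x); rewrite enum_rankK_in.
Qed.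

(** * Kernels on balls as iterated cores *)

Section CosetGraph.

Variables (gT : finGroupType) (K K1 K2 : {group gT}).
Hypothesis sK1K : K1 \subset K.
Hypothesis neqK12 : #|K1| != #|K2|.

Local Notation e := (coset_adj K K1 K2).

Lemma ballP (r : rel {set gT}) z i u :
  reflect (exists2 p, size p <= i & path r z p /\ last z p = u)
          (u \in ball r z i).
Proof.
rewrite inE; apply: (iffP existsP) => [[n /existsP[p /andP[ep /eqP lp]]] | [p]].
  by exists p => //; rewrite size_tuple -ltnS.
rewrite -ltnS => sp [ep lp]; exists (Ordinal sp).
by apply/existsP; exists (in_tuple p); rewrite /= ep lp eqxx.
Qed.

Lemma ball_refl (r : rel {set gT}) z i : z \in ball r z i.
Proof. by apply/ballP; exists [::]. Qed.

Lemma ballS (r : rel {set gT}) z i u :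
  reflect (u = z \/ exists2 w, r z w & u \in ball r w i) (u \in ball r z i.+1).
Proof.
apply: (iffP (ballP _ _ _ _)) => [[[|w p] sp [rp lp]]|].
- by left.
- by case/andP: rp => rzw rp; right; exists w => //; apply/ballP; exists p.
case=> [->|[w rzw /ballP[p sp [rp lp]]]]; first by exists [::].
by exists (w :: p) => //=; rewrite rzw.
Qed.

Lemma vkerP (r : rel {set gT}) (G : {group gT}) z i y :
  reflect (y \in G /\ {in ball r z i, forall u, u :* y = u})
          (y \in vker r G z i).
Proof.
apply: (iffP setIP) => [[/setIP[Gy _] /astabP fy]|[Gy fy]].
  by split=> // u /fy; rewrite /= rcosetE.
split; last by apply/astabP=> u /fy; rewrite /= rcosetE.
by apply/setIP; split=> //; apply/astab1P; rewrite /= rcosetE fy ?ball_refl.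
Qed.

Lemma vker_sub (r : rel {set gT}) (G K0 : {group gT}) z i :
  G \subset K0 -> vker r G z i = G :&: vker r K0 z i :> {set gT}.
Proof.
move=> sGK; apply/setP=> y.
apply/vkerP/setIP=> [[Gy fy]|[Gy /vkerP[_ fy]]]; last by [].
by split=> //; apply/vkerP; split=> //; apply: (subsetP sGK).
Qed.

Lemma eq_vker (r r' : rel {set gT}) (G : {group gT}) z i :
  r =2 r' -> vker r G z i = vker r' G z i :> {set gT}.
Proof.
move=> rr'; have bb : ball r z i =i ball r' z i.
  move=> u; apply/ballP/ballP=> -[p sp [rp lp]]; exists p => //; split=> //.
    by rewrite -(eq_path rr').
  by rewrite (eq_path rr').
by apply/setP=> y; apply/vkerP/vkerP=> -[Gy fy]; split=> // u Bu; apply: fy; rewrite ?bb // -bb.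
Qed.

Lemma vstabE (G J : {group gT}) : vstab G J = G :&: J :> {set gT}.
Proof. by rewrite /= astab1Rs. Qed.

Lemma vker0 (r : rel {set gT}) (G J : {group gT}) : vker r G J 0 = G :&: J :> {set gT}.
Proof.
apply/setP=> y; rewrite -vstabE; apply/idP/idP=> [/setIP[]//|].
case/setIP=> Gy /astab1P; rewrite /= rcosetE => Jy.
by apply/vkerP; split=> // u /ballP[[|//] _ [_ <-]].
Qed.

Lemma rcosets_translate (J : {group gT}) u g :
  g \in K -> (u :* g \in rcosets J K) = (u \in rcosets J K).
Proof.
move=> Kg; apply/rcosetsP/rcosetsP=> -[h Kh def_u].
  exists (h * g^-1); first by rewrite groupM ?groupV.
  by rewrite rcosetM -def_u rcosetK.
by exists (h * g); rewrite ?groupM // rcosetM def_u.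
Qed.

Lemma coset_adj_translate g u v : g \in K -> e (u :* g) (v :* g) = e u v.
Proof.
move=> Kg; rewrite /coset_adj /= !rcosets_translate //; congr (_ && ~~ _).
have -> : u :* g :&: v :* g = (u :&: v) :* g.
  by apply/setP=> x; rewrite !(mem_rcoset, inE).
by rewrite -!cards_eq0 card_rcoset.
Qed.

Lemma ball_translate g z i u :
  g \in K -> (u :* g \in ball e (z :* g) i) = (u \in ball e z i).
Proof.
have tr h z' u' : h \in K -> u' \in ball e z' i -> u' :* h \in ball e (z' :* h) i.
  move=> Kh /ballP[p sp [ep lp]]; apply/ballP.
  exists [seq w :* h | w <- p]; rewrite ?size_map //; split; last by rewrite -lp (last_map (fun w => w :* h)).
  move: ep {lp sp}; elim: p z' => //= w p IHp z' /andP[ezw /IHp->]; rewrite andbT.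
  by rewrite coset_adj_translate.
move=> Kg; apply/idP/idP; last exact: tr.
by move/(tr g^-1); rewrite !rcosetK; apply; rewrite groupV.
Qed.

(** Vertices are bare sets, so [K1] might also occur as a coset of [K2]; the different orders of the
    two groups exclude this. A coset of [K2] that meets [K1] has a representative in [K1]. *)
Lemma nbhd_coset : nbhd e K1 = rcosets K2 K1.
Proof.
apply/setP=> u; rewrite inE; apply/andP/rcosetsP=> [[]|[g K1g ->]].
  case/orP=> [/andP[_ /rcosetsP[g Kg ->]]|/andP[/rcosetsP[g _ eqK] _]].
    case/set0Pn=> x /setIP[K1x K2x]; exists x => //.
    by apply: rcoset_eqP; rewrite rcoset_sym.
  by case/negP: neqK12; rewrite eqK card_rcoset.
split; last by apply/set0Pn; exists g; rewrite inE K1g rcoset_refl.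
apply/orP; left; apply/andP; split; apply/rcosetsP.
  by exists 1; rewrite ?group1 // mulg1.
by exists g => //; apply: (subsetP sK1K).
Qed.

Lemma card_nbhd_coset : #|nbhd e K1| = #|K1 : K1 :&: K2|.
Proof. by rewrite nbhd_coset -orbitRs card_orbit astab1Rs. Qed.

(** The ball of radius i + 1 about [K1] is [K1] together with the balls of radius i about the cosets
    [K2 :* g], g in [K1], and these are the translates by g of the ball about [K2]. Fixing a
    translate pointwise is the same as having a conjugate that fixes the original ball. *)
Lemma vkerS i : vker e K K1 i.+1 = gcore (K1 :&: vker e K K2 i) K1 :> {set gT}.
Proof.
have adj g : g \in K1 -> e K1 (K2 :* g).
  move=> K1g; have: K2 :* g \in nbhd e K1 by rewrite nbhd_coset; apply/rcosetsP; exists g.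
  by rewrite inE.
apply/setP=> y; apply/vkerP/bigcapP=> [[Ky fy] g K1g|fy].
  have K1y : y \in K1.
    by have := fy _ (ball_refl _ _ _) => <-; rewrite rcoset_refl.
  rewrite mem_conjg inE groupJ ?groupV //=; apply/vkerP; split.
    by rewrite groupJ // groupV (subsetP sK1K).
  move=> u Bu; apply: (can_inj (rcosetK g)).
  rewrite conjgE invgK !rcosetM rcosetKV.
  apply: fy; apply/ballS; right; exists (K2 :* g); first exact: adj.
  by rewrite ball_translate // (subsetP sK1K).
have /setIP[K1y _] : y \in K1 :&: vker e K K2 i by rewrite -[_ :&: _]conjsg1 fy.
split=> [|u /ballS[->|[w]]]; first exact: (subsetP sK1K).
  by rewrite rcoset_id.
move=> ew; have: w \in nbhd e K1 by rewrite inE.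
rewrite nbhd_coset => /rcosetsP[g K1g ->].
have Kg : g \in K by apply: (subsetP sK1K).
rewrite -{1 2}(rcosetKV g u) ball_translate // => Bu.
have := fy g K1g; rewrite mem_conjg => /setIP[_ /vkerP[_ /(_ _ Bu)]].
rewrite conjgE invgK !rcosetM rcosetKV => /(can_inj (rcosetKV g)).
by rewrite ?rcosetKV.
Qed.

(** * The permutation group induced on the neighbours of a vertex *)

Section NeighbourhoodPermutations.

Variable G : {group gT}.

Lemma vstab_acts_nbhd : vstab G K1 \subset 'N(nbhd e K1 | 'Rs).
Proof.
rewrite vstabE nbhd_coset; apply: subset_trans (subsetIr _ _) _.
exact: actsRs_rcosets.
Qed.

Lemma vker1E : vker e G K1 1 = 'C_(vstab G K1)(nbhd e K1 | 'Rs) :> {set gT}.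
Proof.
apply/setP=> y; rewrite vstabE; apply/vkerP/setIP=> [[Gy fy]|[/setIP[Gy K1y] /astabP fy]].
  split; first by rewrite inE Gy -(fy _ (ball_refl _ _ _)) rcoset_refl.
  apply/astabP=> u; rewrite inE /= rcosetE => eu; apply: fy.
  by apply/ballS; right; exists u; last exact: ball_refl.
split=> // u /ballS[->|[w ew /ballP[[|//] _ [_ <-]]]]; first by rewrite rcoset_id.
by have:= fy w; rewrite inE /= rcosetE; apply.
Qed.

(** [restr_perm] is a morphism only on permutations that stabilise the neighbourhood, so the image
    of the vertex stabiliser must first be placed in that domain; then the kernel of the composite
    is the kernel on the ball of radius 1. *)
Lemma card_nbhd_perms :
  #|nbhd_perms e G K1| = #|vstab G K1 : vker e G K1 1|.
Proof.
have sN : actperm 'Rs @* vstab G K1 \subset 'N(nbhd e K1 | 'P).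
  apply/subsetP=> _ /morphimP[y _ Gy ->]; rewrite !inE /=.
  apply/subsetP=> u uN; rewrite inE /= apermE actpermE.
  by rewrite (astabs_act _ (subsetP vstab_acts_nbhd y Gy)).
rewrite /nbhd_perms /= -morphim_comp card_morphim ker_comp ker_restr_perm.
rewrite vker1E -(indexgI (vstab G K1)).
have -> : actperm_morphism 'Rs @*^-1 'N(nbhd e K1 | 'P) :&: vstab G K1 = vstab G K1.
  by apply/setIidPr; rewrite -sub_morphim_pre ?subsetT.
rewrite -[in LHS]indexgI; congr #|_ : _|; apply/setP=> y; rewrite !in_setI.
apply: andb_id2l => /andP[Gy Jy]; rewrite Gy Jy /= !inE /=.
suff -> : [set x | aperm x (actperm 'Rs y) == x] = [set x | rcoset x y == x] by [].
by apply/setP=> u; rewrite !inE apermE actpermE.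
Qed.

Lemma nbhd_perms_Sym : nbhd_perms e G K1 \subset perm.Sym (nbhd e K1).
Proof.
by apply/subsetP=> _ /morphimP[p _ _ ->]; rewrite inE restr_perm_on.
Qed.

(** The induced group lies in the symmetric group of the neighbourhood, so a lower bound for its
    order identifies it. *)
Lemma nbhd_perms_isog :
    #|nbhd e K1|`! <= #|vstab G K1 : vker e G K1 1| ->
  nbhd_perms e G K1 \isog [set: 'S_(#|nbhd e K1|)].
Proof.
move=> leS; suff -> : nbhd_perms e G K1 :=: perm.Sym (nbhd e K1) by apply: Sym_isog.
by apply/eqP; rewrite eqEcard nbhd_perms_Sym perm.card_Sym card_nbhd_perms.
Qed.

End NeighbourhoodPermutations.
End CosetGraph.

Local Close Scope group_scope.

(** * Monomial semilinear maps *)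

(* (p, e, k) stands for the semilinear map v |-> (beta^(e_j) * v_(p_j)^(2^k))_j;
   modulo scalars one can take e_0 = 0. *)
Definition mcode : Type := (seq nat * seq nat * nat)%type.

Definition perms3 : seq (seq nat) :=
  [:: [:: 0; 1; 2]; [:: 1; 2; 0]; [:: 2; 0; 1];
      [:: 0; 2; 1]; [:: 1; 0; 2]; [:: 2; 1; 0]].

Definition exps : seq (seq nat) :=
  [seq e <- [seq [:: 0; i; j] | i <- iota 0 9, j <- iota 0 9]
    | 3 %| nth 0 e 1 + nth 0 e 2].

Definition mcodes : seq mcode :=
  [seq (pe, k) | pe <- [seq (p, e) | p <- perms3, e <- exps], k <- iota 0 6].

(* The congruence on i + j is the condition det = 1, up to cubes, satisfied by all
   generators of K2. *)
Definition mvalid (x : mcode) : bool :=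
  [&& x.1.1 \in perms3,
      (if x.1.2 is [:: 0; i; j] then [&& i < 9, j < 9 & 3 %| i + j] else false)
    & x.2 < 6].

(* Codes before normalisation: composition holds for them, injectivity does not. *)
Definition wvalid (x : mcode) : bool :=
  [&& x.1.1 \in perms3, size x.1.2 == 3 & x.2 < 6].

Definition pow2mod9 (k : nat) : nat := nth 0 [:: 1; 2; 4; 8; 7; 5] k.

(* Multiplies by beta^(- f 0), which is beta^(8 * f 0). *)
Definition normexp (f : nat -> nat) : seq nat :=
  let s := 8 * f 0 in [seq (f j + s) %% 9 | j <- [:: 0; 1; 2]].

(** [x] acts first, as in [{perm _}]; hence the exponents of [x] are multiplied by the power of 2
    that belongs to the Frobenius of [y]. *)
Definition cmul (x y : mcode) : mcode :=
  ([seq nth 0 x.1.1 j | j <- y.1.1],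
   normexp (fun j => nth 0 y.1.2 j + pow2mod9 y.2 * nth 0 x.1.2 (nth 0 y.1.1 j)),
   (x.2 + y.2) %% 6).

Definition cone : mcode := ([:: 0; 1; 2], [:: 0; 0; 0], 0).

Definition cinv (x : mcode) : mcode :=
  let k := (6 - x.2) %% 6 in
  let p := [seq index j x.1.1 | j <- [:: 0; 1; 2]] in
  (p, normexp (fun j => 8 * pow2mod9 k * nth 0 x.1.2 (nth 0 p j)), k).

Definition cconj (x g : mcode) : mcode := cmul (cinv g) (cmul x g).

Definition cA : mcode := ([:: 1; 2; 0], [:: 0; 0; 0], 0).
Definition cB : mcode := ([:: 0; 1; 2], [:: 0; 3; 6], 0).
Definition cC : mcode := ([:: 0; 1; 2], [:: 0; 3; 3], 0).
Definition cE : mcode := ([:: 0; 1; 2], [:: 0; 1; 8], 0).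
Definition cF : mcode := ([:: 0; 2; 1], [:: 0; 0; 0], 0).
Definition cS : mcode := ([:: 0; 1; 2], [:: 0; 0; 0], 1).
Definition cS2 : mcode := ([:: 0; 1; 2], [:: 0; 0; 0], 2).
Definition cS3 : mcode := ([:: 0; 1; 2], [:: 0; 0; 0], 3).
Definition cSF : mcode := ([:: 0; 2; 1], [:: 0; 0; 0], 1).
Definition cS3F : mcode := ([:: 0; 2; 1], [:: 0; 0; 0], 3).
Definition cBi : mcode := ([:: 0; 1; 2], [:: 0; 6; 3], 0).
Definition cCi : mcode := ([:: 0; 1; 2], [:: 0; 6; 6], 0).

Definition ceval (w : seq mcode) : mcode := foldr cmul cone w.

Definition even_perm (x : mcode) : bool :=
  x.1.1 \in [:: [:: 0; 1; 2]; [:: 1; 2; 0]; [:: 2; 0; 1]].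
Definition id_perm (x : mcode) : bool := x.1.1 == [:: 0; 1; 2].
Definition inT (x : mcode) : bool := all (dvdn 3) x.1.2.
Definition inU (x : mcode) : bool :=
  x.1.2 \in [:: [:: 0; 0; 0]; [:: 0; 3; 6]; [:: 0; 6; 3]].
Definition inH (x : mcode) : bool := 3 %| x.2.

(* V_i, W_i are the codes of K_{x_i}^[1] and of its O_3, Z2 those of Z(O_3(K_{x_2}^[1]))
   and Z1 those of Z(K1); [meetH] gives the corresponding subgroups of H. *)
Definition inV1 x := inU x && ~~ odd x.2.
Definition inW1 x := [&& inU x, even_perm x & ~~ odd x.2].
Definition inV2 x := inT x && (even_perm x == ~~ odd x.2).
Definition inW2 x := [&& inT x, even_perm x & ~~ odd x.2].
Definition inZ2 x := [&& inU x, id_perm x & ~~ odd x.2].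
Definition inZ1 x := [&& x.1.2 == [:: 0; 0; 0], id_perm x & ~~ odd x.2].
Definition meetH (P : pred mcode) x := P x && inH x.

(** The table follows the order of [perms3]. *)
Definition pword (p : seq nat) : seq mcode :=
  nth [::] [:: [::]; [:: cA]; [:: cA; cA]; [:: cF]; [:: cA; cF]; [:: cA; cA; cF]]
    (index p perms3).

(* Solves diag(1, beta^i, beta^-i) * diag(1, a, a)^j = diag(1, beta^(e_1), beta^(e_2)). *)
Definition eword (gE gC : mcode) (q : nat) (e : seq nat) : seq mcode :=
  let j := (2 * ((nth 0 e 1 + nth 0 e 2) %/ 3)) %% 3 in
  nseq (((nth 0 e 1 + 6 * j) %% 9) %/ q) gE ++ nseq j gC.

(** Normal forms over generators of K2, of its intersection with H, and of T: evaluating the word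
    gives back the code, which turns a condition on codes into membership in a generated group. *)
Definition word2 (x : mcode) := nseq x.2 cS ++ pword x.1.1 ++ eword cE cC 1 x.1.2.
Definition wordH (x : mcode) :=
  nseq (x.2 %/ 3) cS3 ++ pword x.1.1 ++ eword cE cC 1 x.1.2.
Definition wordT (x : mcode) := nseq x.2 cS ++ pword x.1.1 ++ eword cB cC 3 x.1.2.

(* Conjugation by D on the generators of U; junk outside U. *)
Definition dimage (g : mcode) : mcode :=
  if g == cA then cBi else if g == cB then cA else if g == cS then cSF else g.

(** [dimage] is applied letter by letter to one chosen word. That it respects the relations of U
    need not be checked on codes, because moving [D] through the word shows that the result is the
    true conjugate. *)
Definition dconj (x : mcode) : mcode := ceval (map dimage (wordT x)).

Definition checkall (P Q : pred mcode) : bool := all Q (filter P mcodes).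

(** Validity of the conjugates is part of the test, since [phi] is injective only on normalised
    codes and closure of [mvalid] under [cmul] is verified case by case. *)
Definition conj_ok (Q : pred mcode) (gs : seq mcode) :=
  checkall Q (fun x => all (fun g => mvalid (cconj x g) && Q (cconj x g)) gs).

Definition dconj_ok (Q : pred mcode) :=
  checkall Q (fun x => inU x && (mvalid (dconj x) && Q (dconj x))).

(** A certificate that Q is the core of P in K2: Q is stable under generators of K2, and conjugation
    by the few elements [gs] already expels from P whatever is outside Q. *)
Definition core2_ok (P Q : pred mcode) (gs : seq mcode) :=
  [&& checkall Q P, conj_ok Q [:: cA; cB; cC; cE; cF; cS]
    & checkall P (fun x => all (fun g => mvalid (cconj x g)) gs &&
                   (all (fun g => P (cconj x g)) gs ==> Q x))].

(* The last clause uses that x ^ D is in T only if x is in U. *)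
Definition core1_ok (P Q : pred mcode) :=
  [&& checkall P inT, checkall Q P, conj_ok Q [:: cA; cB; cC; cS], dconj_ok Q &
      checkall P (fun x => mvalid (cconj x cC) &&
        ([&& P (cconj x cC), inU x, inU (cconj x cC) & P (dconj x)] ==> Q x))].

Definition closed_ok (Q : pred mcode) :=
  Q cone && let s := filter Q mcodes in
  all (fun x => all (fun y => mvalid (cmul x y) && Q (cmul x y)) s) s.

Definition central_ok (P Q : pred mcode) (gs : seq mcode) :=
  [&& checkall Q P, checkall Q (fun x => checkall P (fun y => cmul x y == cmul y x)),
      all (fun g => mvalid g && P g) gs &
      checkall P (fun x =>
        all (fun g => mvalid (cmul x g) && mvalid (cmul g x)) gs &&
        (all (fun g => cmul x g == cmul g x) gs ==> Q x))].

(** * Elementary properties of codes, words and their products *)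

Lemma checkP (P Q : pred mcode) :
  checkall P Q -> forall x, x \in mcodes -> P x -> Q x.
Proof. by move/allP=> PQ x mx Px; apply: PQ; rewrite mem_filter Px. Qed.

Lemma mem_pairs (S T : eqType) (s : seq S) (t : seq T) a b :
  ((a, b) \in [seq (x, y) | x <- s, y <- t]) = (a \in s) && (b \in t).
Proof.
apply/allpairsP/andP=> [[[x y] [/= ? ? [-> ->]]] | []] //.
by exists (a, b).
Qed.

Lemma mem_exps e : (e \in exps) =
  if e is [:: 0; i; j] then [&& i < 9, j < 9 & 3 %| i + j] else false.
Proof.
have -> : exps = [seq [:: 0; ij.1; ij.2] |
    ij <- [seq (i, j) | i <- iota 0 9, j <- iota 0 9] & 3 %| ij.1 + ij.2] by vm_compute.
apply/mapP/idP=> [[[i j]]|].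
  rewrite mem_filter mem_pairs !mem_iota => /and3P[dv ii jj] ->.
  by apply/and3P.
case: e => [|[|//] [|i [|j [|//]]]] // /and3P[ii jj dv]; exists (i, j) => //.
by rewrite mem_filter mem_pairs !mem_iota ii jj dv.
Qed.

Lemma mem_mcodes x : (x \in mcodes) = mvalid x.
Proof. by case: x => [[p e] k]; rewrite !mem_pairs mem_exps mem_iota -andbA. Qed.

Lemma mcodes_uniq : uniq mcodes.
Proof.
apply: allpairs_uniq; [|exact: iota_uniq|by move=> [? ?] [? ?] ? ? [-> ->]].
apply: allpairs_uniq; [by []|exact: filter_uniq|by move=> [? ?] [? ?] ? ? [-> ->]].
Qed.

Lemma mvalid_wvalid x : mvalid x -> wvalid x.
Proof. by rewrite /wvalid => /and3P[-> + ->]; case: x.1.2 => [|[|?] [|? [|? [|]]]]. Qed.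

Lemma perms3_comp p q : p \in perms3 -> q \in perms3 ->
  [seq nth 0 p j | j <- q] \in perms3.
Proof.
move=> pp qq; have: all (fun p => all (fun q => [seq nth 0 p j | j <- q] \in perms3) perms3) perms3 by [].
by move/allP/(_ p pp)/allP/(_ q qq).
Qed.

Lemma wvalid_mul x y : wvalid x -> wvalid y -> wvalid (cmul x y).
Proof.
move=> /and3P[px _ _] /and3P[py _ _].
by rewrite /wvalid /= perms3_comp //= ltn_mod.
Qed.

Lemma wvalid_ceval w : all wvalid w -> wvalid (ceval w).
Proof. by elim: w => //= g w IHw /andP[vg /IHw]; apply: wvalid_mul. Qed.

Lemma cinv_ok x : mvalid x ->
  [&& mvalid (cinv x), cmul x (cinv x) == cone & cmul (cinv x) x == cone].
Proof.
rewrite -mem_mcodes; move: x; apply/allP.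
by vm_compute.
Qed.

Lemma word2_ok x : mvalid x -> ceval (word2 x) = x.
Proof.
by rewrite -mem_mcodes => mx; apply/eqP; move: x mx; apply/allP; vm_compute.
Qed.

Lemma wordH_ok x : mvalid x -> inH x -> ceval (wordH x) = x.
Proof.
rewrite -mem_mcodes => mx hx; apply/eqP; move: x mx hx.
by apply: checkP; vm_compute.
Qed.

Lemma wordT_ok x : mvalid x -> inT x -> ceval (wordT x) = x.
Proof.
rewrite -mem_mcodes => mx hx; apply/eqP; move: x mx hx.
by apply: checkP; vm_compute.
Qed.

(** For a code in U the exponents add up to 0 or 9, so [eword] uses no letter [cC], the one
    generator of T on which [dimage] has no meaning. *)
Lemma wordU_ok x : mvalid x -> inU x ->
  inT x && all [in [:: cA; cB; cF; cS]] (wordT x).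
Proof.
rewrite -mem_mcodes; move: x.
by apply: checkP; vm_compute.
Qed.

Definition gens2 : seq mcode := [:: cA; cB; cC; cE; cF; cS2; cS3].

Lemma gens2_ok x g : mvalid x -> g \in gens2 -> mvalid (cmul x g) && mvalid g.
Proof.
rewrite -mem_mcodes => mx; move: g; apply/allP; move: x mx; apply/allP.
by vm_compute.
Qed.

Definition gensT : seq mcode := [:: cA; cB; cC; cF; cS].

Lemma gensT_ok x g : mvalid x -> inT x -> g \in gensT ->
  [&& mvalid (cmul x g), inT (cmul x g) & mvalid g].
Proof.
rewrite -mem_mcodes => mx Tx; move: g; apply/allP; move: x mx Tx.
by apply: checkP; vm_compute.
Qed.

Lemma wordT_gens x : mvalid x -> inT x -> all [in gensT] (wordT x).
Proof.
rewrite -mem_mcodes; move: x.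
by apply: checkP; vm_compute.
Qed.

(** The elements 1, C and C^-1 form a transversal of U in T, which leaves only these three cases
    when an element of T meets [D]. *)
Lemma T_decomp x : mvalid x -> inT x ->
  exists2 g, g \in [:: cone; cC; cCi] &
    [&& mvalid (cmul (cinv g) x), inU (cmul (cinv g) x),
        cmul g (cmul (cinv g) x) == x & (g == cone) ==> inU x].
Proof.
rewrite -mem_mcodes => mx Tx; apply/hasP; move: x mx Tx.
by apply: checkP; vm_compute.
Qed.

Lemma dconj_inT x : mvalid x -> inU x -> mvalid (dconj x) && inT (dconj x).
Proof.
rewrite -mem_mcodes; move: x.
by apply: checkP; vm_compute.
Qed.

Lemma dconj_wvalid : all wvalid (map dimage [:: cA; cB; cF; cS]).
Proof. by []. Qed.

Definition cube_ok (Q : pred mcode) := checkall Q (fun x => ceval (nseq 3 x) == cone).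

Definition abelian_ok (Q : pred mcode) :=
  checkall Q (fun x => checkall Q (fun y => cmul x y == cmul y x)).

(** * Certificates evaluated on all codes *)

Lemma closed_W1 : closed_ok inW1. Proof. by vm_compute. Qed.
Lemma closed_W2 : closed_ok inW2. Proof. by vm_compute. Qed.
Lemma closed_HW1 : closed_ok (meetH inW1). Proof. by vm_compute. Qed.
Lemma closed_HW2 : closed_ok (meetH inW2). Proof. by vm_compute. Qed.
Lemma sub_W1_V1 : checkall inW1 inV1. Proof. by vm_compute. Qed.
Lemma sub_W2_V2 : checkall inW2 inV2. Proof. by vm_compute. Qed.
Lemma sub_HW1_HV1 : checkall (meetH inW1) (meetH inV1). Proof. by vm_compute. Qed.
Lemma sub_HW2_HV2 : checkall (meetH inW2) (meetH inV2). Proof. by vm_compute. Qed.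
Lemma cube_W1 : cube_ok (meetH inW1). Proof. by vm_compute. Qed.
Lemma cube_W2 : cube_ok (meetH inW2). Proof. by vm_compute. Qed.
Lemma abelian_W1 : abelian_ok (meetH inW1). Proof. by vm_compute. Qed.
Lemma central_W2 : central_ok inW2 inZ2 [:: cA; cB; cC]. Proof. by vm_compute. Qed.
Lemma central_HW2 : central_ok (meetH inW2) (meetH inZ2) [:: cA; cB; cC].
Proof. by vm_compute. Qed.
Lemma central_T : central_ok inT inZ1 gensT. Proof. by vm_compute. Qed.
Lemma dconj_Z1 : checkall inZ1 (fun x => inU x && (dconj x == x)).
Proof. by vm_compute. Qed.
Lemma comm_S2_W : checkall inW2 (fun x => cmul cS2 x == cmul x cS2).
Proof. by vm_compute. Qed.
Lemma count_codes :
  [/\ count inV1 mcodes = 54, count inW1 mcodes = 27, count inV2 mcodes = 162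
    & count inW2 mcodes = 81]
  /\ [/\ count (meetH inV1) mcodes = 18, count (meetH inW1) mcodes = 9,
         count (meetH inV2) mcodes = 54 & count (meetH inW2) mcodes = 27]
  /\ [/\ count inZ1 mcodes = 3, count inZ2 mcodes = 9, count (meetH inZ2) mcodes = 3
       & count (meetH predT) mcodes = 324].
Proof. by vm_compute. Qed.

Lemma trivial_HZ1 : checkall (meetH inZ1) (pred1 cone). Proof. by vm_compute. Qed.

(** C fixes x_2 and permutes the other three neighbours of x_1 cyclically. Modulo <B>, it is
    centralised by A, B and F and inverted by sigma, which squares a. So the elements of U with an
    even power of sigma are those that fix all four neighbours. *)
Lemma core1_T : core1_ok inT inV1. Proof. by vm_compute. Qed.
Lemma core1_V2 : core1_ok inV2 inW1. Proof. by vm_compute. Qed.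
Lemma core1_Z2 : core1_ok inZ2 inZ1. Proof. by vm_compute. Qed.
(** E permutes the three neighbours of x_2 cyclically. Modulo the diagonal matrices of T it is
    centralised by even permutations and inverted both by odd ones and by sigma, as 2 = -1 modulo 3.
    Hence the kernel requires the two signs in [inV2] to agree. *)
Lemma core2_T : core2_ok inT inV2 [:: cE]. Proof. by vm_compute. Qed.
Lemma core2_V1 : core2_ok inV1 inZ2 [:: cE]. Proof. by vm_compute. Qed.
Lemma core2_W1 : core2_ok inW1 inZ2 [:: cE]. Proof. by vm_compute. Qed.
(** Conjugation by E multiplies a nontrivial power of sigma^2 by a nontrivial power of E^3 = B, so
    it leaves <sigma^2>. This is where the chain of kernels ends. *)
Lemma core2_Z1 : core2_ok inZ1 (pred1 cone) [:: cE]. Proof. by vm_compute. Qed.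

Local Open Scope group_scope.

(** * The amalgam *)

Lemma isog_Zp_prime (gT : finGroupType) (G : {group gT}) p :
  prime p -> #|G| = p -> G \isog Zp p.
Proof.
move=> p_pr oG; have oZ : #|Zp p| = p by rewrite card_Zp ?prime_gt0.
rewrite isog_cyclic_card; last by rewrite prime_cyclic ?oG.
by rewrite oG oZ eqxx prime_cyclic ?oZ.
Qed.

(** Applied with z = sigma^2, of order 3. Leaving [B] free allows the same lemma to give both W_i x
    C_3 and C_3 x C_3. *)
Lemma isog_setX_cycle (gT rT : finGroupType) (A G : {group gT}) (B : {group rT})
    (z : gT) p : prime p -> #[z] = p -> A \subset G -> z \in G -> z \in 'C(A) ->
  z \notin A -> #|G| = (#|A| * p)%N -> A \isog B -> G \isog setX B (Zp p).
Proof.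
move=> p_pr oz sAG Gz cAz nAz oG isoAB.
have tiAz : A :&: <[z]> = 1.
  by rewrite setIC prime_TIg -?orderE ?oz // cycle_subG.
have defG : A \x <[z]> = G.
  rewrite dprodE ?cycle_subG //; apply/eqP; rewrite eqEcard mul_subG ?cycle_subG //=.
  by rewrite TI_cardMg // -orderE oz oG.
apply: isog_dprod defG (setX_dprod _ _) _ _.
  exact: isog_trans isoAB (isog_setX1 _ _).
by apply: isog_trans (isog_set1X _ _); apply: isog_Zp_prime.
Qed.

(** A 3-subgroup of index 2 is normal and Sylow. This replaces the abstract O_3 by an explicit set
    of codes. *)
Lemma pcore3_index2 (gT : finGroupType) (N G : {group gT}) n :
  N \subset G -> #|N| = (3 ^ n)%N -> #|G| = (2 * 3 ^ n)%N -> 'O_3(G) = N.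
Proof.
move=> sNG oN oG; have n0 : (0 < 3 ^ n)%N by rewrite expn_gt0.
apply: normal_Hall_pcore; last first.
  by apply: index2_normal => //; rewrite -divgS // oG oN mulnK.
by rewrite /pHall sNG -divgS // oG oN mulnK // /pgroup oN pnatX.
Qed.

Lemma isog_sdprod_pcore3 (gT : finGroupType) (G : {group gT}) t n :
  t \in G -> #[t] = 2 -> #|'O_3(G)| = (3 ^ n)%N -> #|G| = (2 * 3 ^ n)%N ->
  isog_sdprod G 'O_3(G) (Zp 2).
Proof.
move=> Gt ot oO oG; exists ('O_3(G))%G, <[t]>%G; split; first exact: isog_refl.
  by apply: isog_Zp_prime; rewrite // -orderE.
have co : coprime #|'O_3(G)| #|<[t]>| by rewrite oO -orderE ot coprimeXl.
have sO : 'O_3(G) \subset G := pcore_sub _ _.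
rewrite sdprodE ?coprime_TIg //; last first.
  by rewrite cycle_subG (subsetP (gFnorm _ _)).
apply/eqP; rewrite eqEcard mul_subG ?cycle_subG //= coprime_cardMg //.
by rewrite oO -orderE ot oG mulnC.
Qed.

(* [S * G = S] amounts to [G] lying in the stabiliser of [S] for right translation. *)
Lemma gen_sub_closed (gT : finGroupType) (A S : {set gT}) :
  1 \in S -> {in S & A, forall x g, x * g \in S} -> <<A>> \subset S.
Proof.
move=> S1 SA; have sA : <<A>> \subset 'C[S | 'Rs].
  rewrite gen_subG; apply/subsetP=> g Ag; apply/astab1P; rewrite /= rcosetE.
  apply/eqP; rewrite eqEcard card_rcoset leqnn andbT.
  by apply/subsetP=> _ /rcosetP[x Sx ->]; apply: SA.
apply/subsetP=> g /(subsetP sA)/astab1P; rewrite /= rcosetE => <-.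
by rewrite mem_rcoset mulgV.
Qed.

(** * The amalgam determined by the codes and the relations of [d] *)

Section Model.

Local Opaque mcodes cmul cinv.

Variables (gT : finGroupType) (phi : mcode -> gT) (a b c d e f s : gT).

Hypothesis phiM : forall x y, wvalid x -> wvalid y -> phi (cmul x y) = phi x * phi y.
Hypothesis phi_inj : {in mvalid &, injective phi}.
Hypotheses (def_a : a = phi cA) (def_b : b = phi cB) (def_c : c = phi cC).
Hypotheses (def_e : e = phi cE) (def_f : f = phi cF) (def_s : s = phi cS).
Hypothesis dd : d * d = f.
Hypothesis ad : a * d = d * phi cBi.
Hypothesis bd : b * d = d * a.
Hypothesis ds : d * s = s * d * f.
Hypothesis dcd : d * c * d = phi cCi * d * phi cCi.
Hypothesis d_notin : forall x, mvalid x -> d <> phi x.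

Definition mH1 : {group gT} := <<[set a; b; c; d; s ^+ 3]>>%G.
Definition mH2 : {group gT} := <<[set a; b; c; e; f; s ^+ 3]>>%G.
Definition mH : {group gT} := <<mH1 :|: mH2>>%G.
Definition mK1 : {group gT} := <<mH1 :|: [set s ^+ 2]>>%G.
Definition mK2 : {group gT} := <<mH2 :|: [set s ^+ 2]>>%G.
Definition mK : {group gT} := <<mK1 :|: mK2>>%G.

Hypothesis mH_inH : forall x, mvalid x -> phi x \in mH -> inH x.

Local Notation K := mK.
Local Notation K1 := mK1.
Local Notation K2 := mK2.
Local Notation H := mH.

Lemma phi1 : phi cone = 1.
Proof. by apply: (mulgI (phi cone)); rewrite -phiM // mulg1. Qed.

Lemma phi_ceval w : all wvalid w -> phi (ceval w) = \prod_(g <- w) phi g.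
Proof.
elim: w => [|g w IHw] /=; first by rewrite big_nil phi1.
by case/andP=> vg vw; rewrite big_cons phiM ?IHw ?wvalid_ceval.
Qed.

Lemma phi_word_in (G : {group gT}) w :
  all wvalid w -> {in w, forall g, phi g \in G} -> phi (ceval w) \in G.
Proof.
move=> vw Gw; rewrite phi_ceval // big_seq; elim/big_ind: _ => //.
exact: groupM.
Qed.

Lemma phiV x : mvalid x -> (phi x)^-1 = phi (cinv x).
Proof.
move=> mx; have /and3P[mi /eqP xi _] := cinv_ok mx.
apply: (mulgI (phi x)); rewrite mulgV -phiM ?xi ?phi1 // ?mvalid_wvalid //.
Qed.

Lemma phiJ x g : mvalid x -> mvalid g -> phi x ^ phi g = phi (cconj x g).
Proof.
move=> /mvalid_wvalid vx mg; have /and3P[/mvalid_wvalid vi _ _] := cinv_ok mg.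
have vg := mvalid_wvalid mg.
by rewrite /cconj !phiM ?wvalid_mul // conjgE phiV.
Qed.

Definition img (P : pred mcode) : {set gT} := [set y in [seq phi x | x <- mcodes & P x]].

Lemma imgP (P : pred mcode) y :
  reflect (exists x, [/\ mvalid x, P x & y = phi x]) (y \in img P).
Proof.
rewrite inE; apply: (iffP mapP) => [[x]|[x [mx Px ->]]].
  by rewrite mem_filter mem_mcodes => /andP[Px mx] ->; exists x.
by exists x; rewrite ?mem_filter ?Px ?mem_mcodes.
Qed.

Lemma mem_img (P : pred mcode) x : mvalid x -> (phi x \in img P) = P x.
Proof.
move=> mx; apply/imgP/idP=> [[y [my Py /phi_inj-> //]]|Px]; by exists x.
Qed.

Lemma card_img (P : pred mcode) : #|img P| = count P mcodes.
Proof.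
rewrite cardsE (card_uniqP _) ?size_map ?size_filter //.
rewrite map_inj_in_uniq ?filter_uniq ?mcodes_uniq // => x y.
by rewrite !mem_filter !mem_mcodes => /andP[_ mx] /andP[_ my]; apply: phi_inj.
Qed.

Lemma checkPv (P Q : pred mcode) : checkall P Q -> forall x, mvalid x -> P x -> Q x.
Proof. by move/checkP=> PQ x; rewrite -mem_mcodes; apply: PQ. Qed.

Lemma imgS (P Q : pred mcode) : checkall P Q -> img P \subset img Q.
Proof.
move=> PQ; apply/subsetP=> y /imgP[x [mx Px ->]]; apply/imgP; exists x; split=> //.
exact: checkPv PQ x mx Px.
Qed.

Lemma img_pred1 : img (pred1 cone) = 1.
Proof.
apply/setP=> y; apply/imgP/set1gP=> [[x [_ /eqP-> ->]]|->].
  exact: phi1.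
by exists cone; rewrite phi1.
Qed.

Local Opaque img.

Lemma img_norm (Q : pred mcode) gs : all mvalid gs -> conj_ok Q gs ->
  {in gs, forall g, phi g \in 'N(img Q)}.
Proof.
move=> /allP mgs ok g gsg; rewrite inE; apply/subsetP=> y; rewrite mem_conjg => /imgP[x [mx Qx def_x]].
rewrite -(conjgKV (phi g) y) def_x.
have /allP/(_ g gsg)/andP[mc Qc] := checkPv ok mx Qx.
by rewrite phiJ ?mem_img //; apply: mgs.
Qed.

Lemma phi_pow x n : wvalid x -> phi x ^+ n = phi (ceval (nseq n x)).
Proof.
move=> vx; elim: n => [|n IHn] /=; first by rewrite phi1.
by rewrite expgS IHn -phiM // wvalid_ceval // all_nseq vx orbT.
Qed.

Lemma s2E : s ^+ 2 = phi cS2.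
Proof. by rewrite def_s phi_pow. Qed.

Lemma s3E : s ^+ 3 = phi cS3.
Proof. by rewrite def_s phi_pow. Qed.

Lemma K2_gens : [/\ phi cA \in K2, phi cB \in K2 & phi cC \in K2]
  /\ [/\ phi cE \in K2, phi cF \in K2 & phi cS \in K2].
Proof.
have sHK : mH2 \subset K2 by rewrite sub_gen ?subsetUl.
have inK x : x \in [set a; b; c; e; f; s ^+ 3] -> x \in K2.
  by move=> xin; apply: (subsetP sHK); apply: mem_gen.
rewrite -def_a -def_b -def_c -def_e -def_f -def_s.
have s2 : s ^+ 2 \in K2 by rewrite mem_gen // !inE eqxx orbT.
have s3 : s ^+ 3 \in K2 by rewrite inK // !inE eqxx ?orbT.
have sK : s \in K2.
  have: (s ^+ 2)^-1 * s ^+ 3 \in K2 by rewrite groupM ?groupV.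
  by rewrite (expgSr s 2) mulKg.
by do 2!split=> //; apply: inK; rewrite !inE eqxx ?orbT.
Qed.

Lemma pword_in p : p \in perms3 -> all [in [:: cA; cF]] (pword p).
Proof. by apply: (allP (_ : all (fun p => all [in [:: cA; cF]] (pword p)) perms3)). Qed.

Lemma nseq_in (g : mcode) n (gs : seq mcode) : g \in gs -> all [in gs] (nseq n g).
Proof. by move=> gin; rewrite all_nseq gin orbT. Qed.

Lemma all_in_sub (gs hs w : seq mcode) : all [in hs] gs -> all [in gs] w -> all [in hs] w.
Proof. by move=> /allP gh /allP wg; apply/allP=> x /wg /gh. Qed.

Lemma word_gens (gS gE gC x : mcode) n q :
    mvalid x -> all [in [:: gS; cA; cF; gE; gC]]
      (nseq n gS ++ pword x.1.1 ++ eword gE gC q x.1.2).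
Proof.
case/and3P=> px _ _; rewrite !all_cat !nseq_in ?inE ?eqxx ?orbT //= andbT.
by apply: all_in_sub (pword_in px); rewrite /= !inE !eqxx !orbT.
Qed.

(** Closure of the codes under right multiplication by the generators gives one inclusion, the
    normal form [word2] the other. *)
Lemma K2E : K2 = img predT :> {set gT}.
Proof.
apply/eqP; rewrite eqEsubset; apply/andP; split.
  have cl : {in img predT & [seq phi g | g <- gens2],
      forall x g, x * g \in img predT}.
    move=> _ _ /imgP[x [mx _ ->]] /mapP[g gin ->].
    have /andP[mxg mg] := gens2_ok mx gin.
    by rewrite -phiM ?mem_img // mvalid_wvalid.
  rewrite -[K2 : {set gT}]/(<<_>> <*> _) joing_idl; apply: gen_sub_closed.
    by apply/imgP; exists cone; rewrite phi1.
  move=> x g xin gin; apply: cl => //; move: gin.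
  rewrite s3E s2E def_a def_b def_c def_e def_f !in_setU !in_set1.
  by do 6?[case/orP]; move/eqP->; rewrite map_f.
apply/subsetP=> _ /imgP[x [mx _ ->]]; rewrite -(word2_ok mx).
have [[kA kB kC] [kE kF kS]] := K2_gens.
have /allP win := word_gens cS cE cC x.2 1 mx.
apply: phi_word_in => [|g /win].
  by apply/allP=> g /win; rewrite !inE; do 4?[case/orP]; move/eqP->.
by rewrite !inE; do 4?[case/orP]; move/eqP->.
Qed.

Lemma inH2_H x : x \in [set a; b; c; e; f; s ^+ 3] -> x \in H.
Proof.
move=> xin; apply: (subsetP (_ : mH2 \subset H)); last exact: mem_gen.
by rewrite sub_gen ?subsetUr.
Qed.

Lemma phi_in_H x : mvalid x -> (phi x \in H) = inH x.
Proof.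
move=> mx; apply/idP/idP; first exact: mH_inH.
move=> Hx; rewrite -(wordH_ok mx Hx).
have /allP win := word_gens cS3 cE cC (x.2 %/ 3) 1 mx.
have gv g : g \in wordH x -> wvalid g /\ phi g \in H.
  move/win; rewrite !inE => /or4P[|||/orP[]] /eqP->; split=> //.
  - by rewrite -s3E inH2_H // !inE eqxx ?orbT.
  - by rewrite -def_a inH2_H // !inE eqxx ?orbT.
  - by rewrite -def_f inH2_H // !inE eqxx ?orbT.
  - by rewrite -def_e inH2_H // !inE eqxx ?orbT.
  - by rewrite -def_c inH2_H // !inE eqxx ?orbT.
apply: phi_word_in => [|g /gv[]//].
by apply/allP=> g /gv[].
Qed.

Lemma setIH_img (P : pred mcode) : H :&: img P = img (meetH P).
Proof.
apply/setP=> y; apply/setIP/imgP=> [[Hy /imgP[x [mx Px def_y]]]|[x [mx /andP[Px Hx] ->]]].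
  by exists x; rewrite /meetH Px -(phi_in_H mx) -def_y.
by rewrite phi_in_H // mem_img.
Qed.

(** Defined by generators, so that it lies in K1 for a trivial reason; equality with K1 :&: K2 has
    to wait for the double coset decomposition of K1. *)
Definition T0 : {group gT} := <<[set y in [seq phi g | g <- gensT]]>>%G.

Lemma T0E : T0 = img inT :> {set gT}.
Proof.
apply/eqP; rewrite eqEsubset; apply/andP; split.
  apply: gen_sub_closed; first by rewrite -phi1 mem_img.
  move=> _ y /imgP[x [mx Tx ->]]; rewrite inE => /mapP[g gin ->].
  have /and3P[mxg Txg mg] := gensT_ok mx Tx gin.
  by rewrite -phiM ?mem_img // mvalid_wvalid.
apply/subsetP=> _ /imgP[x [mx Tx ->]]; rewrite -(wordT_ok mx Tx).
have /allP win := wordT_gens mx Tx.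
apply: phi_word_in => [|g /win gin].
  by apply/allP=> g /win gin; have /and3P[_ _ /mvalid_wvalid] := gensT_ok mx Tx gin.
by apply: mem_gen; rewrite inE map_f.
Qed.

Lemma d_notin_K2 : d \notin K2.
Proof. by apply/negP; rewrite K2E => /imgP[x [mx _]]; apply: d_notin. Qed.

Lemma ff : f * f = 1.
Proof. by rewrite def_f -phiM // -phi1; congr phi; vm_compute. Qed.

Lemma cci : c * phi cCi = 1.
Proof. by rewrite def_c -phiM // -phi1; congr phi; vm_compute. Qed.

Lemma dinv : d^-1 = f * d.
Proof. by apply: (mulIg d); rewrite mulVg -mulgA dd ff. Qed.

Lemma fd : f * d = d * f.
Proof. by rewrite -dd mulgA. Qed.

Lemma sub_T0_K2 : T0 \subset K2.
Proof. by rewrite T0E K2E; apply/subsetP=> _ /imgP[x [mx _ ->]]; rewrite mem_img. Qed.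

Lemma T0_gens : [/\ a \in T0, b \in T0 & c \in T0]
  /\ [/\ f \in T0, s \in T0 & phi cCi \in T0].
Proof.
by rewrite def_a def_b def_c def_f def_s T0E !mem_img.
Qed.

(** By the relation for d c d, the conjugate c^d is f c^-1 d c^-1, in which only d is outside K2.
    This keeps T and its conjugate by d from meeting in more than U. *)
Lemma cd_notin_K2 : c ^ d \notin K2.
Proof.
have [[_ _ Tc] [Tf _ Tci]] := T0_gens; apply: contra d_notin_K2.
have sT := subsetP sub_T0_K2.
have -> : c ^ d = f * phi cCi * d * phi cCi.
  by rewrite conjgE dinv -mulgA (mulgA d) dcd !mulgA.
by rewrite (groupMr _ (sT _ Tci)) groupMl // sT // groupM.
Qed.

Lemma dimage_comm g : g \in [:: cA; cB; cF; cS] -> phi g * d = d * phi (dimage g).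
Proof.
rewrite !inE => /or4P[] /eqP->.
- by rewrite -def_a ad.
- by rewrite -def_b bd def_a.
- by rewrite -def_f fd def_f.
have -> : phi (dimage cS) = s * f.
  by rewrite def_s def_f -phiM //; congr phi; vm_compute.
by rewrite -def_s mulgA ds -mulgA ff mulg1.
Qed.

Lemma phi_d x : mvalid x -> inU x -> phi x * d = d * phi (dconj x).
Proof.
move=> mx Ux; have /andP[Tx /allP win] := wordU_ok mx Ux.
rewrite -{1}(wordT_ok mx Tx) /dconj; move: (wordT x) win {Tx} => w win.
have vw : all wvalid w by apply/allP=> g /win; apply/allP.
have vdw : all wvalid (map dimage w).
  by rewrite all_map; apply/allP=> g /win; apply/allP; exact: dconj_wvalid.
rewrite !phi_ceval // big_map; elim: w win {vw vdw} => [|g w IHw] win.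
  by rewrite !big_nil mulg1 mul1g.
rewrite !big_cons -mulgA IHw; last by move=> h hw; rewrite win // inE hw orbT.
by rewrite !mulgA dimage_comm // win // inE eqxx.
Qed.

Lemma phi_Jd x : mvalid x -> inU x -> phi x ^ d = phi (dconj x).
Proof. by move=> mx Ux; rewrite conjgE phi_d // mulKg. Qed.

(** Write x = g u with u in U and g one of 1, C, C^-1. Since u^d lies in K2, so must g^d, which
    excludes C and C^-1. *)
Lemma inU_Jd x : mvalid x -> inT x -> phi x ^ d \in K2 -> inU x.
Proof.
move=> mx Tx; have [g gin /and4P[mu Uu /eqP def_x imp]] := T_decomp mx Tx.
rewrite -{1}def_x phiM ?mvalid_wvalid //; last by move: g gin {mu Uu def_x imp}; apply/allP.
have /andP[mdu _] := dconj_inT mu Uu.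
rewrite conjMg (phi_Jd mu Uu) groupMr; last by rewrite K2E mem_img.
move: gin imp; rewrite !inE => /or3P[] /eqP-> //.
  by rewrite -def_c (negPf cd_notin_K2).
have -> : phi cCi = c^-1 by apply: (mulgI c); rewrite cci mulgV.
by rewrite conjVg groupV (negPf cd_notin_K2).
Qed.

(** The inverse of the relation for d c d, rewritten with d^-1 = f d; it treats the representative
    C^-1 in the double coset computation. *)
Lemma dcid : d * phi cCi * d = c * f * d * c.
Proof.
have cif : f * phi cCi * f = phi cCi.
  by rewrite def_f -!phiM //; congr phi; vm_compute.
have /(congr1 invg) := dcd; rewrite !invMg.
have -> : c^-1 = phi cCi by apply: (mulgI c); rewrite mulgV cci.
have -> : (phi cCi)^-1 = c by apply: (mulIg (phi cCi)); rewrite mulVg cci.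
rewrite {1}dinv fd mulgA -(mulgA d f) {1}dinv !mulgA -(mulgA d) -(mulgA d) cif => ->.
by rewrite dinv !mulgA.
Qed.

Lemma K1_gens : [/\ a \in K1, b \in K1 & c \in K1] /\ [/\ d \in K1, f \in K1 & s \in K1].
Proof.
have sHK : mH1 \subset K1 by rewrite sub_gen ?subsetUl.
have inK x : x \in [set a; b; c; d; s ^+ 3] -> x \in K1.
  by move=> xin; apply: (subsetP sHK); apply: mem_gen.
have s2 : s ^+ 2 \in K1 by rewrite mem_gen // !inE eqxx orbT.
have s3 : s ^+ 3 \in K1 by rewrite inK // !inE eqxx ?orbT.
have sK : s \in K1.
  have: (s ^+ 2)^-1 * s ^+ 3 \in K1 by rewrite groupM ?groupV.
  by rewrite (expgSr s 2) mulKg.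
have dK : d \in K1 by apply: inK; rewrite !inE eqxx ?orbT.
have fK : f \in K1 by rewrite -dd groupM.
by do 2!split=> //; apply: inK; rewrite !inE eqxx ?orbT.
Qed.

Lemma sub_T0_K1 : T0 \subset K1.
Proof.
have [[aK bK cK] [dK fK sK]] := K1_gens.
rewrite gen_subG; apply/subsetP=> y; rewrite inE => /mapP[g gin ->].
by move: gin; rewrite !inE => /or4P[|||/orP[]] /eqP->;
  rewrite -?def_a -?def_b -?def_c -?def_f -?def_s.
Qed.

Lemma K1E : K1 = T0 :|: (T0 :* d) * T0 :> {set gT}.
Proof.
have [[Ta Tb Tc] [Tf Ts Tci]] := T0_gens.
have [[aK bK cK] [dK fK sK]] := K1_gens; have sTK := subsetP sub_T0_K1.
apply/eqP; rewrite eqEsubset; apply/andP; split; last first.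
  apply/subsetP=> y /setUP[/sTK //|/mulsgP[_ u /rcosetP[t Tt ->] Tu ->]].
  by rewrite !groupM //; apply: sTK.
have clT y t : y \in T0 :|: (T0 :* d) * T0 -> t \in T0 -> y * t \in T0 :|: (T0 :* d) * T0.
  move=> /setUP[Ty|/mulsgP[x u xin Tu ->]] Tt; first by rewrite inE groupM.
  by rewrite inE -mulgA mem_mulg ?orbT // groupM.
have inR t u : t \in T0 -> u \in T0 -> t * d * u \in T0 :|: (T0 :* d) * T0.
  by move=> Tt Tu; rewrite inE mem_mulg ?orbT // mem_rcoset mulgK.
rewrite -[K1 : {set gT}]/(<<_>> <*> _) joing_idl; apply: gen_sub_closed.
  by rewrite inE group1.
move=> y g yin gin.
have [->|Tg] : g = d \/ g \in T0; last exact: clT.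
  move: gin; rewrite !in_setU !in_set1 -!orbA.
  by case/or4P=> [/eqP->|/eqP->|/eqP->|/or3P[] /eqP->]; auto; right; rewrite groupX.
case/setUP: yin => [Ty|/mulsgP[_ u /rcosetP[t Tt ->] Tu ->]].
  by rewrite -[y * d]mulg1 inR.
(* For the product t d x d, split x = h u with u in U and h in {1, C, C^-1}. The factor u passes
   through d into T, and d h d is f, or by the braid relation and its inverse lies in T d T. *)
move: Tu; rewrite {1}T0E => /imgP[x [mx Tx ->]].
have [h hin /and4P[mv Uv /eqP def_x _]] := T_decomp mx Tx.
have vh : wvalid h by move: h hin {mv Uv def_x}; apply/allP.
have /andP[mdv Tdv] := dconj_inT mv Uv.
have Tdv' : phi (dconj (cmul (cinv h) x)) \in T0 by rewrite T0E mem_img.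
have -> : t * d * phi x * d = t * (d * phi h * d) * phi (dconj (cmul (cinv h) x)).
  have -> : phi x = phi h * phi (cmul (cinv h) x).
    by rewrite -phiM ?def_x // mvalid_wvalid.
  by rewrite -!mulgA (phi_d mv Uv).
apply: clT => //.
rewrite !inE in hin; case/or3P: hin => /eqP->.
- by rewrite phi1 mulg1 dd inE groupM.
- by rewrite -def_c dcd !mulgA inR // groupM.
by rewrite dcid !mulgA inR // !groupM.
Qed.

Lemma setI_K12 : K1 :&: K2 = img inT.
Proof.
rewrite -T0E; apply/eqP; rewrite eqEsubset subsetI sub_T0_K1 sub_T0_K2 !andbT.
apply/subsetP=> y /setIP[]; rewrite K1E.
case/setUP=> // /mulsgP[_ u /rcosetP[t Tt ->] Tu ->].
have sT := subsetP sub_T0_K2.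
by rewrite (groupMr _ (sT _ Tu)) (groupMl _ (sT _ Tt)) (negPf d_notin_K2).
Qed.

Lemma card_T0 : #|T0| = 324.
Proof. by rewrite T0E card_img; vm_compute. Qed.

Lemma card_K2 : #|K2| = 972.
Proof. by rewrite K2E card_img; vm_compute. Qed.

(** The double coset of d has 324 * 324 / 108 = 972 elements, 108 being the order of U, and it is
    disjoint from T. *)
Lemma card_K1 : #|K1| = 1296.
Proof.
have tiU : T0 :&: T0 :^ d^-1 = img inU.
  apply/setP=> y; rewrite inE mem_conjgV {1}T0E.
  apply/andP/imgP=> [[/imgP[x [mx Tx ->]] Txd]|[x [mx Ux ->]]].
    by exists x; split=> //; apply: inU_Jd => //; apply: (subsetP sub_T0_K2).
  have /andP[Tx _] := wordU_ok mx Ux; have /andP[md Td] := dconj_inT mx Ux.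
  by rewrite phi_Jd // mem_img // T0E mem_img.
have oTT : #|(T0 :* d) * T0| = 972.
  have -> : T0 :* d = d *: (T0 :^ d) by rewrite conjsgE lcosetKV.
  rewrite -mulgA card_lcoset; apply/eqP.
  have oI : #|T0 :^ d :&: T0| = 108.
    rewrite -(cardJg _ d^-1) conjIg conjsgK tiU.
    by rewrite card_img; vm_compute.
  have := mul_cardG (T0 :^ d)%G T0; rewrite /= oI cardJg card_T0.
  by rewrite -{2}[324]/(3 * 108)%N mulnA => /eqP; rewrite eqn_pmul2r // eq_sym.
rewrite K1E cardsU card_T0 oTT.
suff -> : T0 :&: (T0 :* d) * T0 = set0 by rewrite cards0.
apply/setP=> y; rewrite in_set0; apply/negP=> /setIP[Ty].
case/mulsgP=> _ u /rcosetP[t Tt ->] Tu def_y; case/negP: d_notin_K2.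
apply: (subsetP sub_T0_K2); move: Ty.
by rewrite def_y groupMr // groupMl.
Qed.

Lemma gcoreP (A : {set gT}) (G : {group gT}) y :
  reflect {in G, forall g, y ^ g \in A} (y \in gcore A G).
Proof.
apply: (iffP bigcapP) => Ay g Gg; last by rewrite mem_conjg Ay ?groupV.
by have := Ay g^-1; rewrite mem_conjgV groupV; apply.
Qed.

(** For y in the core, the conjugates by d and by c d stay in K2, which forces the codes of y and
    y^c into U. Then y^d is given by [dconj], and the last clause of the certificate applies. *)
Lemma gcore1_img (P Q : pred mcode) : core1_ok P Q -> gcore (img P) K1 = img Q.
Proof.
have [[aK bK cK] [dK fK sK]] := K1_gens.
case/and5P=> PT QP okQ okdQ okP; apply/eqP; rewrite eqEsubset; apply/andP; split.
  apply/subsetP=> y /gcoreP fy; have /imgP[x [mx Px def_y]] : y \in img P.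
    by rewrite -(conjg1 y) fy.
  have sPK2 z : z \in img P -> z \in K2 by case/imgP=> w [mw _ ->]; rewrite K2E mem_img.
  have Tx := checkPv PT mx Px; have /andP[mxc /implyP imp] := checkPv okP mx Px.
  have mC : mvalid cC by [].
  have xc : phi (cconj x cC) = y ^ c by rewrite def_y def_c phiJ.
  have Pxc : P (cconj x cC) by rewrite -(mem_img P mxc) xc fy.
  have Ux : inU x by apply: inU_Jd => //; rewrite -def_y sPK2 ?fy.
  have Uxc : inU (cconj x cC).
    apply: (inU_Jd mxc (checkPv PT mxc Pxc)).
    by rewrite xc -conjgM sPK2 ?fy ?groupM.
  have /andP[mdx _] := dconj_inT mx Ux.
  have Pdx : P (dconj x) by rewrite -(mem_img P mdx) -phi_Jd // -def_y fy.
  by rewrite def_y mem_img // imp // Pxc Ux Uxc.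
apply: gcore_max; first exact: imgS.
have nQ := img_norm (_ : all mvalid [:: cA; cB; cC; cS]) okQ.
have [na nb nc ns] : [/\ a \in 'N(img Q), b \in 'N(img Q), c \in 'N(img Q) & s \in 'N(img Q)].
  by rewrite def_a def_b def_c def_s !nQ.
have nd : d \in 'N(img Q).
  rewrite inE; apply/subsetP=> y; rewrite mem_conjg => /imgP[x [mx Qx def_x]].
  rewrite -(conjgKV d y) def_x; have /and3P[Ux mdx Qdx] := checkPv okdQ mx Qx.
  by rewrite phi_Jd // mem_img.
rewrite -[K1 : {set gT}]/(<<_>> <*> _) joing_idl gen_subG; apply/subsetP=> g.
rewrite !in_setU !in_set1 -!orbA.
by case/or4P=> [/eqP->|/eqP->|/eqP->|/or3P[] /eqP->] //; rewrite groupX.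
Qed.

Lemma gcore2_img (P Q : pred mcode) gs : all mvalid gs -> core2_ok P Q gs ->
  gcore (img P) K2 = img Q.
Proof.
move=> /allP mgs /and3P[QP okQ okP]; apply/eqP; rewrite eqEsubset; apply/andP; split.
  apply/subsetP=> y /gcoreP fy; have /imgP[x [mx Px def_y]] : y \in img P.
    by rewrite -(conjg1 y) fy.
  have /andP[/allP mc /implyP imp] := checkPv okP mx Px.
  rewrite def_y mem_img // imp //; apply/allP=> g gin.
  have mg := mgs g gin; rewrite -(mem_img P (mc g gin)) -phiJ // -def_y.
  by apply: fy; rewrite K2E mem_img.
apply: gcore_max; first exact: imgS.
have nQ := img_norm (_ : all mvalid [:: cA; cB; cC; cE; cF; cS]) okQ.
have ns : s \in 'N(img Q) by rewrite def_s nQ.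
rewrite -[K2 : {set gT}]/(<<_>> <*> _) joing_idl gen_subG; apply/subsetP=> g.
rewrite !in_setU !in_set1.
by do 6?[case/orP]; move/eqP->;
  rewrite ?groupX // ?def_a ?def_b ?def_c ?def_e ?def_f nQ.
Qed.

Local Notation Delta := (coset_adj K K1 K2).

Lemma K1_sub : K1 \subset K. Proof. by rewrite sub_gen ?subsetUl. Qed.
Lemma K2_sub : K2 \subset K. Proof. by rewrite sub_gen ?subsetUr. Qed.

Lemma neq_K12 : #|K1| != #|K2|. Proof. by rewrite card_K1 card_K2. Qed.
Lemma neq_K21 : #|K2| != #|K1|. Proof. by rewrite eq_sym neq_K12. Qed.

Lemma DeltaC : Delta =2 coset_adj K K2 K1.
Proof. by move=> u v; rewrite /coset_adj /= orbC. Qed.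

Lemma vker_K1 i : vker Delta K K1 i.+1 = gcore (K1 :&: vker Delta K K2 i) K1 :> {set gT}.
Proof. exact: vkerS K1_sub neq_K12 i. Qed.

Lemma vker_K2 i : vker Delta K K2 i.+1 = gcore (K2 :&: vker Delta K K1 i) K2 :> {set gT}.
Proof.
rewrite [in RHS](eq_vker K K1 i DeltaC) [in LHS](eq_vker K K2 i.+1 DeltaC).
exact: vkerS K2_sub neq_K21 i.
Qed.

Lemma core1_sub (P Q : pred mcode) : core1_ok P Q -> checkall P inT.
Proof. by case/and5P. Qed.

Lemma setIK1_img (P : pred mcode) : checkall P inT -> K1 :&: img P = img P.
Proof.
by move=> PT; apply/setIidPr; rewrite (subset_trans (imgS PT)) // -T0E sub_T0_K1.
Qed.

Lemma setIK2_img (P : pred mcode) : K2 :&: img P = img P.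
Proof.
by apply/setIidPr; rewrite K2E; apply/subsetP=> _ /imgP[x [mx _ ->]]; rewrite mem_img.
Qed.

Lemma vker_K1_1 : vker Delta K K1 1 = img inV1 :> {set gT}.
Proof.
by rewrite vker_K1 vker0 (setIidPr K2_sub) setI_K12 (gcore1_img core1_T).
Qed.

Lemma vker_K2_1 : vker Delta K K2 1 = img inV2 :> {set gT}.
Proof.
rewrite vker_K2 vker0 (setIidPr K1_sub) setIC setI_K12.
by rewrite (gcore2_img (isT : all mvalid [:: cE]) core2_T).
Qed.

Lemma vker_K1_2 : vker Delta K K1 2 = img inW1 :> {set gT}.
Proof.
by rewrite vker_K1 vker_K2_1 (setIK1_img (core1_sub core1_V2)) (gcore1_img core1_V2).
Qed.

Lemma vker_K2_2 : vker Delta K K2 2 = img inZ2 :> {set gT}.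
Proof.
by rewrite vker_K2 vker_K1_1 setIK2_img (gcore2_img (isT : all mvalid [:: cE]) core2_V1).
Qed.

Lemma vker_K1_3 : vker Delta K K1 3 = img inZ1 :> {set gT}.
Proof.
by rewrite vker_K1 vker_K2_2 (setIK1_img (core1_sub core1_Z2)) (gcore1_img core1_Z2).
Qed.

(** Passing from [inV1] to [inW1] discards the odd permutations, which the core in K2 loses anyway;
    hence the kernels at x_2 for radii 2 and 3 coincide, and so do those at x_1 for radii 3 and
    4. *)
Lemma vker_K2_3 : vker Delta K K2 3 = img inZ2 :> {set gT}.
Proof.
by rewrite vker_K2 vker_K1_2 setIK2_img (gcore2_img (isT : all mvalid [:: cE]) core2_W1).
Qed.

Lemma vker_K1_4 : vker Delta K K1 4 = img inZ1 :> {set gT}.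
Proof.
by rewrite vker_K1 vker_K2_3 (setIK1_img (core1_sub core1_Z2)) (gcore1_img core1_Z2).
Qed.

Lemma vker_K2_4 : vker Delta K K2 4 :=: 1.
Proof.
by rewrite vker_K2 vker_K1_3 setIK2_img (gcore2_img (isT : all mvalid [:: cE]) core2_Z1) img_pred1.
Qed.

Lemma vker_K1_5 : vker Delta K K1 5 :=: 1.
Proof.
rewrite vker_K1 vker_K2_4; apply/trivgP; apply: subset_trans (gcore_sub _ _) _.
exact: subsetIr.
Qed.

Lemma sub_H_K : H \subset K.
Proof.
rewrite gen_subG subUset; apply/andP; split.
  by apply: subset_trans K1_sub; rewrite sub_gen ?subsetUl.
by apply: subset_trans K2_sub; rewrite sub_gen ?subsetUl.
Qed.

Lemma vker_H z i (P : pred mcode) : vker Delta K z i = img P :> {set gT} ->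
  vker Delta H z i = img (meetH P) :> {set gT}.
Proof. by move=> EP; rewrite (vker_sub _ _ _ sub_H_K) EP setIH_img. Qed.

Lemma img_group_set (Q : pred mcode) : closed_ok Q -> group_set (img Q).
Proof.
case/andP=> Q1 /allP cl; apply/group_setP; split; first by rewrite -phi1 mem_img.
move=> _ _ /imgP[x [mx Qx ->]] /imgP[y [my Qy ->]].
have fin z : mvalid z -> Q z -> z \in [seq z <- mcodes | Q z].
  by move=> mz Qz; rewrite mem_filter Qz mem_mcodes.
have /allP/(_ y (fin y my Qy))/andP[mxy Qxy] := cl x (fin x mx Qx).
by rewrite -phiM ?mem_img // mvalid_wvalid.
Qed.

Lemma pcore3_img (G : {group gT}) (P Q : pred mcode) n :
    G :=: img P -> closed_ok Q -> checkall Q P -> count Q mcodes = (3 ^ n)%N ->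
  count P mcodes = (2 * 3 ^ n)%N -> 'O_3(G) = img Q.
Proof.
move=> EG clQ QP oQ oP; apply: (pcore3_index2 (N := Group (img_group_set clQ)) (n := n)).
- by rewrite EG imgS.
- by rewrite /= card_img.
by rewrite EG card_img.
Qed.

Lemma center_img (G : {group gT}) (P Q : pred mcode) gs :
  G :=: img P -> central_ok P Q gs -> 'Z(G) = img Q.
Proof.
move=> EG /and4P[QP comQ /allP gsP comP]; apply/setP=> y.
apply/centerP/imgP=> [[]|[x [mx Qx ->]]].
  rewrite {1}EG => /imgP[x [mx Px ->]] cx; exists x; split=> //.
  have /andP[/allP mxg /implyP] := checkPv comP mx Px; apply.
  apply/allP=> g gin; have /andP[mg Pg] := gsP g gin; have /andP[mxg1 mgx] := mxg g gin.
  apply/eqP/phi_inj => //; rewrite !phiM ?mvalid_wvalid //.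
  by apply: cx; rewrite EG mem_img.
split=> [|z]; first by rewrite EG mem_img // (checkPv QP mx Qx).
rewrite EG => /imgP[w [mw Pw ->]]; rewrite /commute -!phiM ?mvalid_wvalid //.
by have /eqP-> := checkPv (checkPv comQ mx Qx) mw Pw.
Qed.

(** If t d u were central, conjugation by d would act on c as conjugation by elements of T does,
    placing c^d in K2. So the centre lies in Z(T), which is <sigma^2>; conversely d commutes with
    sigma^2, its entries being in F_4. *)
Lemma center_K1 : 'Z(K1) = img inZ1.
Proof.
have [[Ta Tb Tc] [Tf Ts Tci]] := T0_gens; have sTK := subsetP sub_T0_K1.
have ET := center_img T0E central_T; apply/setP=> z; apply/idP/idP.
  case/centerP=> K1z cz; suff Tz : z \in T0.
    by rewrite -ET; apply/centerP; split=> // y /sTK; apply: cz.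
  move: K1z; rewrite K1E => /setUP[//|/mulsgP[_ u /rcosetP[t Tt ->] Tu def_z]].
  case/negP: cd_notin_K2; have -> : d = t^-1 * z * u^-1.
    by rewrite def_z !mulgA mulVg mul1g mulgK.
  rewrite 2!conjgM [X in X ^ u^-1]conjgE -cz ?mulKg; last by rewrite sTK // groupJ ?groupV.
  by rewrite (subsetP sub_T0_K2) // !groupJ ?groupV.
case/imgP=> x [mx Zx def_z]; have /andP[Ux /eqP dx] := checkPv dconj_Z1 mx Zx.
have: z \in 'Z(T0) by rewrite ET def_z mem_img.
case/centerP=> Tz cz; apply/centerP; split; first exact: sTK.
suff sK : K1 \subset 'C[z] by move=> y /(subsetP sK) /cent1P /commute_sym.
have inC y : y \in T0 -> y \in 'C[z] by move=> Ty; apply/cent1P/commute_sym/cz.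
have dC : d \in 'C[z].
  apply/cent1P; apply/commute_sym/commgP/conjg_fixP.
  by rewrite def_z phi_Jd // dx.
rewrite -[K1 : {set gT}]/(<<_>> <*> _) joing_idl gen_subG; apply/subsetP=> g.
rewrite !in_setU !in_set1 -!orbA.
by case/or4P=> [/eqP->|/eqP->|/eqP->|/or3P[] /eqP->] //; rewrite ?groupX ?inC.
Qed.

Lemma order_s2 : #[s ^+ 2] = 3.
Proof.
have ns2 : s ^+ 2 != 1 by rewrite s2E -phi1; apply/eqP => /phi_inj; move/(_ isT isT).
apply: nt_prime_order => //.
by rewrite s2E phi_pow // -phi1; congr phi; vm_compute.
Qed.

Lemma order_F : #[phi cF] = 2.
Proof.
have nF : phi cF != 1 by rewrite -phi1; apply/eqP => /phi_inj; move/(_ isT isT).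
by apply: nt_prime_order => //; rewrite phi_pow // -phi1; congr phi; vm_compute.
Qed.

(** In the kernel at x_2 an odd permutation needs an odd power of sigma, so F does not belong to it.
    The involution sigma^3 F does and also lies in H, which gives a complement to O_3 in both
    groups. *)
Lemma order_S3F : #[phi cS3F] = 2.
Proof.
have nF : phi cS3F != 1 by rewrite -phi1; apply/eqP => /phi_inj; move/(_ isT isT).
by apply: nt_prime_order => //; rewrite phi_pow // -phi1; congr phi; vm_compute.
Qed.

Lemma order_A : #[phi cA] = 3.
Proof.
have nF : phi cA != 1 by rewrite -phi1; apply/eqP => /phi_inj; move/(_ isT isT).
by apply: nt_prime_order => //; rewrite phi_pow // -phi1; congr phi; vm_compute.
Qed.

(** K1 is generated by a subgroup of H and the central element sigma^2 of order 3, so the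
    intersection has index at most 3. The field automorphism test is of no help here, since elements
    of T d T have no code. *)
Lemma card_HK1 : 432 <= #|H :&: K1|.
Proof.
have s2Z : s ^+ 2 \in 'Z(K1) by rewrite center_K1 s2E mem_img.
have cZ : <[s ^+ 2]> \subset 'C(H :&: K1).
  rewrite cycle_subG; apply: subsetP s2Z; apply: subset_trans (subsetIr _ _) _.
  by rewrite centS ?subsetIr.
have sK : K1 \subset (H :&: K1) * <[s ^+ 2]>.
  rewrite -cent_joinEr // -[K1 : {set gT}]/(<<_ :|: _>>) genS // setUSS ?sub1set ?cycle_id //.
  by rewrite subsetI !sub_gen ?subsetUl.
have := subset_leq_card sK.
have := dvdn_cardMg (H :&: K1)%G <[s ^+ 2]>%G => /dvdn_leq.
rewrite muln_gt0 !cardG_gt0 => /(_ isT) le1 le2; have := leq_trans le2 le1.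
by rewrite card_K1 -orderE order_s2 -[1296]/(432 * 3)%N leq_pmul2r.
Qed.

Lemma vstab_K1 : vstab K K1 = K1 :> {set gT}.
Proof. by rewrite vstabE (setIidPr K1_sub). Qed.

Lemma vstab_K2 : vstab K K2 = K2 :> {set gT}.
Proof. by rewrite vstabE (setIidPr K2_sub). Qed.

Lemma card_nbhd1 : #|nbhd Delta K1| = 4.
Proof.
rewrite (card_nbhd_coset K1_sub neq_K12) -divgS ?subsetIl //.
by rewrite /= setI_K12 -T0E card_T0 card_K1 -[1296]/(4 * 324)%N mulnK.
Qed.

Lemma nbhdC z : nbhd Delta z = nbhd (coset_adj K K2 K1) z.
Proof. by apply/setP=> u; rewrite !in_set DeltaC. Qed.

Lemma card_nbhd2 : #|nbhd Delta K2| = 3.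
Proof.
rewrite nbhdC (card_nbhd_coset K2_sub neq_K21) -divgS ?subsetIl //.
by rewrite /= setIC setI_K12 -T0E card_T0 card_K2 -[972]/(3 * 324)%N mulnK.
Qed.

Lemma nbhd_perms_K1 (G : {group gT}) :
  24 * #|vker Delta G K1 1| <= #|vstab G K1| -> nbhd_perms Delta G K1 \isog [set: 'S_4].
Proof.
move=> le24; rewrite -card_nbhd1; apply: (nbhd_perms_isog K1_sub neq_K12).
rewrite card_nbhd1 -(leq_pmul2r (cardG_gt0 (vker Delta G K1 1))).
by rewrite mulnC [X in _ <= X]mulnC Lagrange ?subsetIl // mulnC.
Qed.

Lemma nbhd_perms_K2 (G : {group gT}) :
  6 * #|vker Delta G K2 1| <= #|vstab G K2| -> nbhd_perms Delta G K2 \isog [set: 'S_3].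
Proof.
rewrite (eq_vker G K2 1 DeltaC) => le6.
have -> : nbhd_perms Delta G K2 = nbhd_perms (coset_adj K K2 K1) G K2.
  by rewrite /nbhd_perms nbhdC.
rewrite -card_nbhd2 nbhdC; apply: (nbhd_perms_isog K2_sub neq_K21).
rewrite -nbhdC card_nbhd2 -(leq_pmul2r (cardG_gt0 (vker (coset_adj K K2 K1) G K2 1))).
by rewrite mulnC [X in _ <= X]mulnC Lagrange ?subsetIl // mulnC.
Qed.

Lemma cS2_cent (A : {set gT}) (P : pred mcode) :
  A = img P -> checkall P inW2 -> s ^+ 2 \in 'C(A).
Proof.
move=> -> PW; apply/centP=> _ /imgP[x [mx Px ->]].
rewrite s2E /commute -!phiM ?mvalid_wvalid //.
by have /eqP-> := checkPv comm_S2_W mx (checkPv PW mx Px).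
Qed.

Lemma s2_in_img (P : pred mcode) : (s ^+ 2 \in img P) = P cS2.
Proof. by rewrite s2E mem_img. Qed.

Theorem amalgam_structure :
  let W1 := 'O_3(vker Delta H K1 1) in
  let W2 := 'O_3(vker Delta H K2 1) in
  let hatW1 := 'O_3(vker Delta K K1 1) in
  let hatW2 := 'O_3(vker Delta K K2 1) in
  [/\ [/\ Delta K1 K2, #|nbhd Delta K1| = 4 & #|nbhd Delta K2| = 3],
      [/\ 3.-abelem W1 /\ #|W1| = 9,
          [/\ special W2, #|W2| = 27 & exponent W2 = 3],
          hatW1 \isog setX W1 (Zp 3)
        & hatW2 \isog setX W2 (Zp 3)]
    & [/\ [/\ nbhd_perms Delta H K1 \isog [set: 'S_4],
              isog_sdprod (vker Delta H K1 1) W1 (Zp 2),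
              vker Delta H K1 2 \isog W1
            & vker Delta H K1 3 :=: 1],
          [/\ nbhd_perms Delta H K2 \isog [set: 'S_3],
              isog_sdprod (vker Delta H K2 1) W2 (Zp 2),
              [/\ vker Delta H K2 2 :=: vker Delta H K2 3,
                  vker Delta H K2 3 :=: 'Z(W2)
                & 'Z(W2) \isog Zp 3]
            & vker Delta H K2 4 :=: 1],
          [/\ nbhd_perms Delta K K1 \isog [set: 'S_4],
              isog_sdprod (vker Delta K K1 1) hatW1 (Zp 2),
              vker Delta K K1 2 \isog hatW1,
              [/\ vker Delta K K1 3 :=: vker Delta K K1 4,
                  vker Delta K K1 4 :=: 'Z(vstab K K1)
                & 'Z(vstab K K1) \isog Zp 3]
            & vker Delta K K1 5 :=: 1]
        & [/\ nbhd_perms Delta K K2 \isog [set: 'S_3],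
              isog_sdprod (vker Delta K K2 1) hatW2 (Zp 2),
              [/\ vker Delta K K2 2 :=: vker Delta K K2 3,
                  vker Delta K K2 3 :=: 'Z(hatW2)
                & 'Z(hatW2) \isog setX (Zp 3) (Zp 3)]
            & vker Delta K K2 4 :=: 1]]].
Proof.
move=> W1 W2 hatW1 hatW2.
have [[nV1 nW1 nV2 nW2] [[nHV1 nHW1 nHV2 nHW2] [nZ1 nZ2 nHZ2 nH]]] := count_codes.
have E1 := vker_H vker_K1_1; have E2 := vker_H vker_K2_1.
have EW1 : W1 = img (meetH inW1).
  exact: (pcore3_img (n := 2) E1 closed_HW1 sub_HW1_HV1 nHW1 nHV1).
have EW2 : W2 = img (meetH inW2).
  exact: (pcore3_img (n := 3) E2 closed_HW2 sub_HW2_HV2 nHW2 nHV2).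
have EhW1 : hatW1 = img inW1.
  exact: (pcore3_img (n := 3) vker_K1_1 closed_W1 sub_W1_V1 nW1 nV1).
have EhW2 : hatW2 = img inW2.
  exact: (pcore3_img (n := 4) vker_K2_1 closed_W2 sub_W2_V2 nW2 nV2).
have oW1 : #|W1| = 9 by rewrite EW1 card_img nHW1.
have oW2 : #|W2| = 27 by rewrite EW2 card_img nHW2.
have ohW1 : #|hatW1| = 27 by rewrite EhW1 card_img nW1.
have ohW2 : #|hatW2| = 81 by rewrite EhW2 card_img nW2.
have oV1 : #|vker Delta K K1 1| = 54 by rewrite vker_K1_1 card_img nV1.
have oV2 : #|vker Delta K K2 1| = 162 by rewrite vker_K2_1 card_img nV2.
have oHV1 : #|vker Delta H K1 1| = 18 by rewrite E1 card_img nHV1.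
have oHV2 : #|vker Delta H K2 1| = 54 by rewrite E2 card_img nHV2.
have ZW2 : 'Z(W2) = img (meetH inZ2) := center_img EW2 central_HW2.
have ZhW2 : 'Z(hatW2) = img inZ2 := center_img EhW2 central_W2.
have oZW2 : #|'Z(W2)| = 3 by rewrite ZW2 card_img nHZ2.
have oZhW2 : #|'Z(hatW2)| = 9 by rewrite ZhW2 card_img nZ2.
have oZK1 : #|'Z(K1)| = 3 by rewrite center_K1 card_img nZ1.
have oHK2 : #|H :&: K2| = 324 by rewrite K2E setIH_img card_img nH.
move=> {nV1 nW1 nV2 nW2 nHV1 nHW1 nHV2 nHW2 nZ1 nZ2 nHZ2 nH}.
have cubeW (A : {set gT}) Q : A = img Q -> cube_ok Q -> exponent A %| 3.
  move=> -> cub; apply/exponentP=> _ /imgP[x [mx Qx ->]].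
  by rewrite phi_pow ?mvalid_wvalid // (eqP (checkPv cub mx Qx)) phi1.
have abW1 : abelian W1.
  apply/centsP=> x; rewrite EW1 => /imgP[u [mu Qu ->]] _ /imgP[v [mv Qv ->]].
  rewrite /commute -!phiM ?mvalid_wvalid //.
  by have /eqP-> := checkPv (checkPv abelian_W1 mu Qu) mv Qv.
have sHW1 : W1 \subset hatW1 by rewrite EW1 EhW1 imgS //; vm_compute.
have sHW2 : W2 \subset hatW2 by rewrite EW2 EhW2 imgS //; vm_compute.
have sZZ : 'Z(W2) \subset 'Z(hatW2) by rewrite ZW2 ZhW2 imgS //; vm_compute.
have s2hW1 : s ^+ 2 \in hatW1 by rewrite EhW1 s2_in_img.
have s2hW2 : s ^+ 2 \in hatW2 by rewrite EhW2 s2_in_img.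
have s2Z : s ^+ 2 \in 'Z(hatW2) by rewrite ZhW2 s2_in_img.
have s2nW1 : s ^+ 2 \notin W1 by rewrite EW1 s2_in_img.
have s2nW2 : s ^+ 2 \notin W2 by rewrite EW2 s2_in_img.
have s2nZ : s ^+ 2 \notin 'Z(W2) by rewrite ZW2 s2_in_img.
have s2cW1 : s ^+ 2 \in 'C(W1) by apply: (cS2_cent EW1); vm_compute.
have s2cW2 : s ^+ 2 \in 'C(W2) by apply: (cS2_cent EW2); vm_compute.
have s2cZ : s ^+ 2 \in 'C('Z(W2)) by apply: (cS2_cent ZW2); vm_compute.
split.
- split; [ | exact: card_nbhd1 | exact: card_nbhd2].
  have: K2 :* 1 \in nbhd Delta K1.
    by rewrite (nbhd_coset K1_sub neq_K12); apply/rcosetsP; exists 1.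
  by rewrite mulg1 inE.
- split.
  + by rewrite abelemE // abW1 (cubeW _ _ EW1 cube_W1).
  + split=> //; first by have [] := card_p3group_extraspecial (isT : prime 3) oW2 oZW2.
    have AW2 : phi cA \in W2 by rewrite EW2 mem_img.
    have := dvdn_exponent AW2; rewrite order_A => dv3.
    by apply/eqP; rewrite eqn_dvd dv3 (cubeW _ _ EW2 cube_W2).
  + apply: (isog_setX_cycle (isT : prime 3) order_s2 sHW1 s2hW1 s2cW1 s2nW1 _ (isog_refl _)).
    by rewrite [LHS]ohW1 oW1.
  + apply: (isog_setX_cycle (isT : prime 3) order_s2 sHW2 s2hW2 s2cW2 s2nW2 _ (isog_refl _)).
    by rewrite [LHS]ohW2 oW2.
split.
- split.
  + by apply: nbhd_perms_K1; rewrite oHV1 vstabE card_HK1.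
  + apply: (isog_sdprod_pcore3 (n := 2)) order_F oW1 oHV1.
    by rewrite E1 mem_img.
  + by rewrite (vker_H vker_K1_2) -EW1 isog_refl.
  by apply/trivgP; rewrite (vker_H vker_K1_3) -img_pred1 imgS ?trivial_HZ1.
- split.
  + by apply: nbhd_perms_K2; rewrite oHV2 vstabE oHK2.
  + apply: (isog_sdprod_pcore3 (n := 3)) order_S3F oW2 oHV2.
    by rewrite E2 mem_img.
  + rewrite (vker_H vker_K2_2) (vker_H vker_K2_3) -ZW2; split=> //.
    exact: (isog_Zp_prime (isT : prime 3) oZW2).
  by apply/trivgP; rewrite (vker_sub _ _ _ sub_H_K) vker_K2_4 subsetIr.
- split.
  + by apply: nbhd_perms_K1; rewrite oV1 vstab_K1 card_K1.
  + apply: (isog_sdprod_pcore3 (n := 3)) order_F ohW1 oV1.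
    by rewrite vker_K1_1 mem_img.
  + by rewrite vker_K1_2 -EhW1 isog_refl.
  + rewrite vker_K1_3 vker_K1_4 vstab_K1 -center_K1; split=> //.
    exact: (isog_Zp_prime (isT : prime 3) oZK1).
  exact: vker_K1_5.
split.
+ by apply: nbhd_perms_K2; rewrite oV2 vstab_K2 card_K2.
+ apply: (isog_sdprod_pcore3 (n := 4)) order_S3F ohW2 oV2.
  by rewrite vker_K2_1 mem_img.
+ rewrite vker_K2_2 vker_K2_3 -ZhW2; split=> //.
  apply: (isog_setX_cycle (isT : prime 3) order_s2 sZZ s2Z s2cZ s2nZ).
    by rewrite [LHS]oZhW2 oZW2.
  exact: (isog_Zp_prime (isT : prime 3) oZW2).
exact: vker_K2_4.
Qed.

End Model.

Local Close Scope group_scope.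

(** * Realisation in PGammaU_3(8) *)

Section Semantics.

Variable F : finFieldType.
Hypothesis cardF : #|F| = 64.
Local Open Scope ring_scope.

Variable b : F.
Hypothesis b_prim : 9.-primitive_root b.

Lemma b9 : b ^+ 9 = 1.
Proof. exact: prim_expr_order b_prim. Qed.

Lemma beta_neq0 : b != 0.
Proof.
apply/eqP=> b0; have := b9; rewrite b0 expr0n /= => /eqP.
by rewrite eq_sym oner_eq0.
Qed.

Lemma eq_beta_exp i j : b ^+ i = b ^+ j -> i = j %[mod 9].
Proof. by move/eqP; rewrite (eq_prim_root_expr b_prim) => /eqP. Qed.

Lemma beta_mod n : b ^+ (n %% 9) = b ^+ n.
Proof. by rewrite (expr_mod _ b9). Qed.

Definition frob (k : nat) (x : F) : F := x ^+ (2 ^ k).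

Lemma frobS k x : frob k.+1 x = rho (frob k x).
Proof. by rewrite /frob /rho expnSr exprM. Qed.

Lemma frobD k : {morph frob k : x y / x + y}.
Proof. by elim: k => [|k IHk] x y //; rewrite !frobS IHk rhoD. Qed.

Lemma frobM k : {morph frob k : x y / x * y}.
Proof. by move=> x y; rewrite /frob exprMn. Qed.

Lemma frob0 k : frob k 0 = 0.
Proof. by rewrite /frob expr0n expn_eq0. Qed.

Lemma frob1 k : frob k 1 = 1.
Proof. by rewrite /frob expr1n. Qed.

Lemma frob_inj k : injective (frob k).
Proof. by elim: k => [|k IHk] x y //; rewrite !frobS => /(rho_inj cardF) /IHk. Qed.

Lemma frob_comp k l x : frob l (frob k x) = frob (k + l) x.
Proof. by rewrite /frob -exprM -expnD. Qed.

Lemma frob_mod k x : frob (k %% 6) x = frob k x.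
Proof.
have f6 y : frob 6 y = y by rewrite /frob -[(2 ^ 6)%N]cardF expf_card.
have f6n n y : frob (n * 6) y = y.
  by elim: n => [|n IHn]; rewrite ?mulSn -?frob_comp ?f6.
by rewrite {2}(divn_eq k 6) -frob_comp f6n.
Qed.

Lemma frob_beta k n : (k < 6)%N -> frob k (b ^+ n) = b ^+ (pow2mod9 k * n).
Proof.
move=> lt_k6; rewrite /frob -exprM mulnC -beta_mod -[RHS]beta_mod; congr (_ ^+ _).
by rewrite -modnMml -[in RHS]modnMml; case: k lt_k6 => [|[|[|[|[|[|]]]]]].
Qed.

Definition row3 (x y z : F) : 'rV[F]_3 := \row_j [:: x; y; z]`_j.

Lemma row3P (v : 'rV[F]_3) : v = row3 (v 0 (inord 0)) (v 0 (inord 1)) (v 0 (inord 2)).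
Proof.
apply/rowP=> j; rewrite mxE -{1}(inord_val j).
by case: j => [[|[|[|//]]] lt_j3].
Qed.

Lemma eq_row3 x y z x' y' z' : x = x' -> y = y' -> z = z' -> row3 x y z = row3 x' y' z'.
Proof. by move=> -> -> ->. Qed.

Lemma scale_row3 c x y z : c *: row3 x y z = row3 (c * x) (c * y) (c * z).
Proof. by apply/rowP=> -[[|[|[|//]]] lt_j3]; rewrite !mxE. Qed.

Lemma mul_row3 x y z (s : seq (seq F)) : row3 x y z *m mx3 s =
  let r (i j : nat) := (nth [::] s i)`_j in
  let col (j : nat) := x * r 0%N j + y * r 1%N j + z * r 2%N j in
  row3 (col 0%N) (col 1%N) (col 2%N).
Proof.
apply/rowP=> j; rewrite !mxE !big_ord_recl big_ord0 !mxE addr0 addrA.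
by case: j => [[|[|[|//]]] lt_j3].
Qed.

Definition mfun (x : mcode) (v : 'rV[F]_3) : 'rV[F]_3 :=
  \row_j (b ^+ nth 0%N x.1.2 j * frob x.2 (v 0 (inord (nth 0%N x.1.1 j)))).

Lemma perms3_nth p i : p \in perms3 -> (i < 3)%N ->
  [/\ size p = 3, (nth 0 p i < 3)%N, (index i p < 3)%N & nth 0%N p (index i p) = i].
Proof.
move=> pP lt_i3; have: all (fun p => (size p == 3) && all (fun i =>
    [&& nth 0 p i < 3, index i p < 3 & nth 0 p (index i p) == i])%N (iota 0 3)) perms3.
  by [].
case/allP/(_ p pP)/andP=> /eqP -> /allP/(_ i); rewrite mem_iota => /(_ lt_i3).
by case/and3P=> ? ? /eqP.
Qed.

Lemma mfun_inj x : wvalid x -> injective (mfun x).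
Proof.
case/and3P=> pP _ _ u v /rowP euv; apply/rowP=> i.
have [_ _ lt_j3 def_i] := perms3_nth pP (ltn_ord i).
have := euv (inord (index (i : nat) x.1.1)); rewrite !mxE inordK // def_i inord_val.
by move/(mulfI (expf_neq0 _ beta_neq0))/frob_inj.
Qed.

Definition mperm (x : mcode) : {perm 'rV[F]_3} := perm_fun (mfun x).

Lemma mpermE x : wvalid x -> mperm x =1 mfun x.
Proof. by move/mfun_inj/perm_funE. Qed.

Lemma sum_perms3 p (f : nat -> F) : p \in perms3 ->
  \sum_(j < 3) f (nth 0%N p j) = \sum_(j < 3) f j.
Proof.
rewrite !big_ord_recl !big_ord0 /= !inE.
by do 5?[case/orP]; move/eqP=> -> /=; ring.
Qed.

Lemma mperm_GammaU x : wvalid x -> mperm x \in GammaU F.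
Proof.
move=> vx; have [pP _ _] := and3P vx.
apply/GammaUP; exists (perm (@frob_inj x.2)).
  by apply/field_autP=> c d; rewrite !permE frobD frobM.
move=> c u v; rewrite !permE !mpermE //; split.
  by apply/rowP=> j; rewrite !mxE frobD frobM; ring.
pose f n := frob x.2 (u 0 (inord n) * tau (v 0 (inord n))).
have -> : frob x.2 (herm u v) = \sum_(j < 3) f j.
  rewrite /herm (big_morph _ (@frobD x.2) (frob0 x.2)).
  by apply: eq_bigr => j _; rewrite /f inord_val.
rewrite -(sum_perms3 f pP); apply: eq_bigr => j _; rewrite !mxE /f frobM !tauE.
(* The powers of beta have norm beta^(9 n) = 1, so monomial maps with such entries preserve the
   form. *)
have e9 n : b ^+ n * (b ^+ n) ^+ 8 = 1 by rewrite -exprS -exprM mulnC exprM b9 expr1n.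
rewrite exprMn mulrACA e9 mul1r.
by rewrite /frob -!exprM [(8 * _)%N]mulnC.
Qed.

Lemma GammaU_norm g : g \in GammaU F -> g \in 'N(scalars F)%g.
Proof. by apply/subsetP; case/andP: (scalars_normal F). Qed.

Lemma barM g h : g \in GammaU F -> h \in GammaU F -> bar (g * h)%g = (bar g * bar h)%g.
Proof. by move=> Gg Gh; rewrite /bar morphM ?GammaU_norm. Qed.

Lemma bar_eq g h c : g \in GammaU F -> h \in GammaU F ->
  (forall v, g v = c *: h v) -> bar g = bar h.
Proof.
move=> Gg Gh egh; rewrite -[g](mulKVg h) barM ?groupM ?groupV //.
have zS : (h^-1 * g)%g \in scalars F.
  apply/scalarsP; split; first by rewrite groupM ?groupV.
  by exists c => v; rewrite permM egh permKV.
by rewrite {2}/bar coset_id ?mulg1.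
Qed.

Lemma bar_inj g h : g \in GammaU F -> h \in GammaU F -> bar g = bar h ->
  exists c, forall v, g v = c *: h v.
Proof.
move=> Gg Gh egh; have Gz : (h^-1 * g)%g \in GammaU F by rewrite groupM ?groupV.
have: (h^-1 * g)%g \in scalars F.
  apply: coset_idr; first exact: GammaU_norm.
  have := barM (groupVr Gh) Gg; rewrite /bar => ->.
  by rewrite -[coset _ g]/(bar g) egh /bar morphV ?GammaU_norm //= mulVg.
case/scalarsP=> _ [c ec]; exists c => v.
by have := ec (h v); rewrite permM permK.
Qed.

Definition mbar (x : mcode) : coset_of (scalars F) := bar (mperm x).

(** The scalar is the one divided out by [normexp]; it disappears in the projective group. *)
Lemma mfun_comp x y v : wvalid x -> wvalid y ->
  mfun y (mfun x v) =
  b ^+ (nth 0 y.1.2 0 + pow2mod9 y.2 * nth 0 x.1.2 (nth 0 y.1.1 0))%N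
    *: mfun (cmul x y) v.
Proof.
case/and3P=> pPx _ lt_x6 /and3P[pPy _ lt_y6]; apply/rowP=> j; rewrite !mxE /=.
have [szy lt_pj _ _] := perms3_nth pPy (ltn_ord j).
rewrite (nth_map 0%N) ?szy // frob_mod -frob_comp inordK // frobM frob_beta //.
set f := fun j => (nth 0 y.1.2 j + pow2mod9 y.2 * nth 0 x.1.2 (nth 0 y.1.1 j))%N.
have -> : nth 0%N (normexp f) j = ((f j + 8 * f 0) %% 9)%N.
  by case: j {lt_pj} => [[|[|[|//]]] ?].
rewrite beta_mod mulrA -exprD [in RHS]mulrA -exprD; congr (_ * _).
rewrite -[X in _ ^+ X = _]/(f j) addnCA -mulSn exprD exprM b9 expr1n.
by rewrite mulr1.
Qed.

Lemma mbarM x y : wvalid x -> wvalid y -> mbar (cmul x y) = (mbar x * mbar y)%g.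
Proof.
move=> vx vy; have vxy := wvalid_mul vx vy.
rewrite /mbar -barM ?mperm_GammaU //; apply/esym/bar_eq; rewrite ?groupM ?mperm_GammaU //.
by move=> v; rewrite permM !mpermE //; apply: mfun_comp.
Qed.

(** Basis vectors detect the permutation. The normalisation e_0 = 0 forces c = 1, the constant
    vector 1 gives the exponents modulo 9, and the constant vector beta gives 2^k modulo 9, which
    determines k because 2 has order 6 modulo 9. *)
Lemma mbar_inj : {in mvalid &, injective mbar}.
Proof.
move=> x y mx my exy; have {}mx : mvalid x := mx; have {}my : mvalid y := my.
have vx := mvalid_wvalid mx; have vy := mvalid_wvalid my.
have [c ec] := bar_inj (mperm_GammaU vx) (mperm_GammaU vy) exy.
have {exy}ec (v : 'rV[F]_3) (j : 'I_3) :
    b ^+ nth 0%N x.1.2 j * frob x.2 (v 0 (inord (nth 0%N x.1.1 j))) =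
    c * (b ^+ nth 0%N y.1.2 j * frob y.2 (v 0 (inord (nth 0%N y.1.1 j)))) :> F.
  by have := ec v; rewrite !mpermE // => /rowP/(_ j); rewrite !mxE.
have [pPx _ lt_x6] := and3P vx; have [pPy _ lt_y6] := and3P vy.
have ep : x.1.1 = y.1.1.
  have [szx _ _ _] := perms3_nth pPx (isT : (0 < 3)%N).
  have [szy _ _ _] := perms3_nth pPy (isT : (0 < 3)%N).
  apply: (@eq_from_nth _ 0%N); rewrite ?szx ?szy // => j lt_j3.
  have [_ lt_px _ _] := perms3_nth pPx lt_j3; have [_ lt_py _ _] := perms3_nth pPy lt_j3.
  have := ec (delta_mx 0 (inord (nth 0%N x.1.1 j))) (Ordinal lt_j3).
  rewrite !mxE !eqxx /= frob1 mulr1.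
  have [/(congr1 val) | _ /eqP] := eqVneq (inord (nth 0%N y.1.1 j) : 'I_3) _.
    by rewrite /= !inordK.
  by rewrite frob0 !mulr0 (negPf (expf_neq0 _ beta_neq0)).
have ev w (j : 'I_3) :
    b ^+ nth 0%N x.1.2 j * frob x.2 w = c * (b ^+ nth 0%N y.1.2 j * frob y.2 w).
  by have := ec (const_mx w) j; rewrite !mxE.
case/and3P: mx => _ + _; case/and3P: my => _ + _.
move: {ec vx vy pPx pPy} ep ev lt_x6 lt_y6.
case: x => [[p e] k]; case: y => [[q f] l] /= -> ev lt_k6 lt_l6.
case: f ev => [|[|//] [|f1 [|f2 [|//]]]] // ev /and3P[lt_f1 lt_f2 _].
case: e ev => [|[|//] [|e1 [|e2 [|//]]]] // ev /and3P[lt_e1 lt_e2 _].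
have c1 : c = 1 by have := ev 1 ord0; rewrite !frob1 /= !mul1r mulr1.
rewrite {}c1 in ev.
have -> : e1 = f1.
  have := ev 1 (Ordinal (isT : (1 < 3)%N)); rewrite !frob1 mul1r !mulr1 /=.
  by move/eq_beta_exp; rewrite !modn_small.
have -> : e2 = f2.
  have := ev 1 (Ordinal (isT : (2 < 3)%N)); rewrite !frob1 mul1r !mulr1 /=.
  by move/eq_beta_exp; rewrite !modn_small.
have := ev b ord0; rewrite /= !mul1r => /eq_beta_exp.
by case: k lt_k6 {ev} => [|[|[|[|[|[|//]]]]]] _; case: l lt_l6 => [|[|[|[|[|[|//]]]]]].
Qed.

Lemma frob_id x : frob 0 x = x. Proof. exact: expr1. Qed.

Lemma mfun_row3 p0 p1 p2 e0 e1 e2 k x y z : (p0 < 3)%N -> (p1 < 3)%N -> (p2 < 3)%N ->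
  mfun ([:: p0; p1; p2], [:: e0; e1; e2], k) (row3 x y z) =
  row3 (b ^+ e0 * frob k [:: x; y; z]`_p0) (b ^+ e1 * frob k [:: x; y; z]`_p1)
       (b ^+ e2 * frob k [:: x; y; z]`_p2).
Proof.
by move=> l0 l1 l2; apply/rowP=> -[[|[|[|//]]] lt_j3]; rewrite !mxE /= inordK.
Qed.

(** * Relations between the Fourier matrix D and the monomial maps *)

Variable D : {perm 'rV[F]_3}.
Hypothesis GD : D \in GammaU F.
Hypothesis DE : forall x y z, D (row3 x y z) =
  row3 (x + y + z) (x + b ^+ 3 * y + b ^+ 6 * z) (x + b ^+ 6 * y + b ^+ 3 * z).

Lemma b6E : b ^+ 6 = -1 - b ^+ 3.
Proof.
have na : b ^+ 3 - 1 != 0 by rewrite subr_eq0 -(prim_order_dvd b_prim).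
by apply: (mulfI na); have := b9 => e9; ring: e9.
Qed.

Lemma mbar_dd : (bar D * bar D)%g = mbar cF.
Proof.
rewrite -barM //; apply: (@bar_eq _ _ 1); rewrite ?groupM ?mperm_GammaU // => v.
rewrite (row3P v) permM mpermE // !DE mfun_row3 // scale1r /= !frob_id.
have t0 := two0 cardF; have e6 := b6E.
(* In characteristic 0 the square of the Fourier matrix is 3 F; the factor 3 equals 1 here, and is
   inserted so that [ring] needs only 1 + a + a^2 = 0. *)
have three w : w = (1 + 2%:R) * w :> F by rewrite t0 addr0 mul1r.
by apply: eq_row3; rewrite [RHS]three; ring: e6.
Qed.

Lemma mbar_ad : (mbar cA * bar D)%g = (bar D * mbar cBi)%g.
Proof.
rewrite -!barM ?mperm_GammaU //; apply: (@bar_eq _ _ 1); rewrite ?groupM ?mperm_GammaU // => v.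
rewrite (row3P v) !permM !mpermE // !DE !mfun_row3 // !DE scale1r /= !frob_id.
have e6 := b6E.
by apply: eq_row3; ring: e6.
Qed.

Lemma mbar_bd : (mbar cB * bar D)%g = (bar D * mbar cA)%g.
Proof.
rewrite -!barM ?mperm_GammaU //; apply: (@bar_eq _ _ 1); rewrite ?groupM ?mperm_GammaU // => v.
rewrite (row3P v) !permM !mpermE // !DE !mfun_row3 // !DE scale1r /= !frob_id.
have e6 := b6E.
by apply: eq_row3; ring: e6.
Qed.

Lemma mbar_ds : (bar D * mbar cS)%g = (mbar cS * bar D * mbar cF)%g.
Proof.
rewrite -!barM ?groupM ?mperm_GammaU //.
apply: (@bar_eq _ _ 1); rewrite ?groupM ?mperm_GammaU // => v.
rewrite (row3P v) !permM !mpermE // !DE !mfun_row3 // !DE !mfun_row3 // scale1r /= !frob_id.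
have e9 := b9.
by apply: eq_row3; rewrite !frobD ?frobM /frob; ring: e9.
Qed.

Lemma mbar_dcd : (bar D * mbar cC * bar D)%g = (mbar cCi * bar D * mbar cCi)%g.
Proof.
rewrite -!barM ?groupM ?mperm_GammaU //.
apply: (@bar_eq _ _ 1); rewrite ?groupM ?mperm_GammaU // => v.
rewrite (row3P v) !permM !mpermE // !DE !mfun_row3 // !DE !mfun_row3 // scale1r /= !frob_id.
have t0 := two0 cardF; have e6 := b6E.
(* In characteristic 0, D C D = (1 + 2 a) C^-1 D C^-1, a Gauss sum. *)
have gauss w : w = (1 + 2%:R * b ^+ 3) * w :> F by rewrite t0 mul0r addr0 mul1r.
by apply: eq_row3; rewrite [RHS]gauss; ring: e6.
Qed.

(** [D] sends the first basis vector to a vector without zero coordinate, whereas a monomial map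
    leaves two coordinates zero. *)
Lemma mbar_d_notin x : mvalid x -> bar D <> mbar x.
Proof.
move=> /mvalid_wvalid vx /(bar_inj GD (mperm_GammaU vx))[c /(_ (row3 1 0 0))].
have [pP _ _] := and3P vx; have [_ _ lt_j3 def_j] := perms3_nth pP (isT : (1 < 3)%N).
rewrite DE mpermE // => /rowP/(_ (Ordinal lt_j3)); rewrite !mxE /= def_j inordK //= frob0.
rewrite !mulr0 !addr0; case: (index _ _) lt_j3 => [|[|[|//]]] _ /= /eqP;
  by rewrite oner_eq0.
Qed.

(** * Detection of the field automorphism by beta + beta^-1 *)

Lemma frob3_omega : frob 3 (b + b ^+ 8) = b + b ^+ 8.
Proof. by rewrite frobD !frob_beta // -[in LHS]beta_mod /= addrC. Qed.

(** Since [frob 3] fixes w, any other Frobenius power fixing w would make [frob 1] fix it, that is w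
    = 0 or w = 1. These would give beta^8 = beta or beta^3 = 1. *)
Lemma frob_omega k : (k < 6)%N -> frob k (b + b ^+ 8) = b + b ^+ 8 -> (3 %| k)%N.
Proof.
move=> lt_k6; have w8 := frob3_omega; move: w8; set w := b + b ^+ 8 => w8 ek.
have nw : frob 1 w <> w.
  move=> /eqP; rewrite /frob expr2 -subr_eq0 -[X in _ - X]mulr1 -mulrBr mulf_eq0.
  case/orP=> [/eqP w0|]; last rewrite subr_eq0 => /eqP w1.
    have: b ^+ 8 = b ^+ 1.
      by apply/eqP; rewrite -subr_eq0 -w0 /w expr1; have t0 := two0 cardF; apply/eqP; rewrite -[LHS]addr0 -(mul0r b) -t0; ring.
    by move/eq_beta_exp.
  have: b ^+ 3 = b ^+ 0.
    have t0 := two0 cardF.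
    have e1 : b * w = b by rewrite w1 mulr1.
    have e2 : b ^+ 2 + 1 = b by rewrite -[RHS]e1 /w mulrDr -!exprS b9.
    have -> : b ^+ 3 = b * (b ^+ 2 + 1) - b by ring.
    have -> : b * (b ^+ 2 + 1) = b ^+ 2 + 1 - 1 by rewrite {1}e2; ring.
    rewrite e2 expr0; apply/eqP; rewrite -subr_eq0; apply/eqP.
    by rewrite -[RHS](mul0r (- 1)) -t0; ring.
  by move/eq_beta_exp.
case: k lt_k6 ek => [|[|[|[|[|[|//]]]]]] _ // ek; case: nw => //.
- by have := frob_comp 2 1 w; rewrite ek => ->.
- by have := frob_comp 3 1 w; rewrite w8 => ->.
have e2 : frob 2 w = w by have := frob_comp 3 2 w; rewrite w8 => ->.
by have := frob_comp 2 1 w; rewrite e2 => ->.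
Qed.

Lemma omega_neq0 : b + b ^+ 8 != 0.
Proof.
by apply/eqP=> w0; have := @frob_omega 1 isT; rewrite w0 frob0 => /(_ erefl).
Qed.

(** Multiplication by beta + beta^-1 commutes with all scalars, so commuting with it depends only on
    the class of g. For a monomial map it means that the Frobenius part fixes beta + beta^-1. *)
Lemma mperm_omega x g (h := perm_fun (fun v : 'rV[F]_3 => (b + b ^+ 8) *: v)) :
  mvalid x -> g \in GammaU F -> g \in 'C[h]%g -> bar g = mbar x -> (3 %| x.2)%N.
Proof.
move=> mx Gg /cent1P cgh egx; have vx := mvalid_wvalid mx.
have hE v : h v = (b + b ^+ 8) *: v by apply: perm_funE; apply/scalerI/omega_neq0.
have [c ec] := bar_inj (mperm_GammaU vx) Gg (esym egx).
have [_ _ lt_k6] := and3P vx; apply: frob_omega => //.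
have := congr1 (fun u : {perm _} => u (const_mx 1)) cgh; rewrite !permM !hE => e1.
have e2 : mfun x ((b + b ^+ 8) *: const_mx 1) = (b + b ^+ 8) *: mfun x (const_mx 1).
  by rewrite -!mpermE // !ec -e1 !scalerA mulrC.
move/rowP/(_ 0): e2; rewrite !mxE mulr1 frob1 mulr1 mulrC.
by move/(mulIf (expf_neq0 _ beta_neq0)).
Qed.

End Semantics.

Section Instance.

Variable F : finFieldType.
Hypothesis cardF : #|F| = 64.
Variable zeta : {unit F}.
Hypothesis gen_zeta : generator [set: {unit F}] zeta.

Local Open Scope ring_scope.

Local Notation b := (beta zeta).

Lemma beta_prim : 9.-primitive_root b.
Proof.
have [m prim_m dv_m] := @prim_order_exists _ 9 b isT (beta9 cardF zeta).
have := a_neq1 cardF gen_zeta; rewrite /a_ -(prim_order_dvd prim_m).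
have: m \in divisors 9 by rewrite -dvdn_divisors.
by rewrite !inE => /or3P[] /eqP e; move: prim_m; rewrite e.
Qed.

Lemma beta_inv : b^-1 = b ^+ 8.
Proof.
apply: (mulfI (beta_neq0 beta_prim)); rewrite divff ?(beta_neq0 beta_prim) //.
by rewrite -exprS (b9 beta_prim).
Qed.

Lemma a_inv : (a_ zeta)^-1 = b ^+ 6.
Proof. by rewrite /a_ -exprVn beta_inv -exprM -[LHS](beta_mod beta_prim). Qed.

Lemma bar_linmap_mfun M x c :
    M \in [:: matA F; matB zeta; matC zeta; matD zeta; matE zeta; matF F] -> wvalid x ->
    (forall y1 y2 y3, row3 y1 y2 y3 *m M = c *: mfun b x (row3 y1 y2 y3)) ->
  bar (linmap M) = mbar b x.
Proof.
move=> Min vx eM; have [ME GM] := genU cardF gen_zeta Min.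
apply: (bar_eq (c := c)) => //; first exact: (mperm_GammaU cardF beta_prim vx).
by move=> v; rewrite ME (mpermE cardF beta_prim) // (row3P v).
Qed.

Lemma bar_matA : bar (linmap (matA F)) = mbar b cA.
Proof.
apply: (@bar_linmap_mfun _ _ 1); rewrite ?inE ?eqxx ?orbT // => y1 y2 y3.
by rewrite mul_row3 mfun_row3 // scale1r /= !frob_id; apply: eq_row3; ring.
Qed.

Lemma bar_matB : bar (linmap (matB zeta)) = mbar b cB.
Proof.
apply: (@bar_linmap_mfun _ _ 1); rewrite ?inE ?eqxx ?orbT // => y1 y2 y3.
rewrite mul_row3 mfun_row3 // scale1r /= !frob_id a_inv /a_.
by apply: eq_row3; ring.
Qed.

Lemma bar_matC : bar (linmap (matC zeta)) = mbar b cC.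
Proof.
(* Dividing C by beta normalises its first entry to 1 and leaves diag(1, a, a), the code [cC]. *)
apply: (@bar_linmap_mfun _ _ b); rewrite ?inE ?eqxx ?orbT // => y1 y2 y3.
rewrite mul_row3 mfun_row3 // scale_row3 /= !frob_id.
by apply: eq_row3; ring.
Qed.

Lemma bar_matE : bar (linmap (matE zeta)) = mbar b cE.
Proof.
apply: (@bar_linmap_mfun _ _ 1); rewrite ?inE ?eqxx ?orbT // => y1 y2 y3.
rewrite mul_row3 mfun_row3 // scale1r /= !frob_id beta_inv.
by apply: eq_row3; ring.
Qed.

Lemma bar_matF : bar (linmap (matF F)) = mbar b cF.
Proof.
apply: (@bar_linmap_mfun _ _ 1); rewrite ?inE ?eqxx ?orbT // => y1 y2 y3.
by rewrite mul_row3 mfun_row3 // scale1r /= !frob_id; apply: eq_row3; ring.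
Qed.

Lemma bar_sigma : bar (sigma F) = mbar b cS.
Proof.
have [sE sG] := sigmaU cardF.
apply: (@bar_eq _ _ _ 1) => // [|v]; first exact: (mperm_GammaU cardF beta_prim).
rewrite sE (mpermE cardF beta_prim) // scale1r (row3P v) mfun_row3 //=.
apply/rowP=> -[[|[|[|//]]] lt_j3]; rewrite !mxE /= mul1r //.
Qed.

Lemma linmap_matD_row3 x y z : linmap (matD zeta) (row3 x y z) =
  row3 (x + y + z) (x + b ^+ 3 * y + b ^+ 6 * z) (x + b ^+ 6 * y + b ^+ 3 * z).
Proof.
have Min : matD zeta \in [:: matA F; matB zeta; matC zeta; matD zeta; matE zeta; matF F].
  by rewrite !inE eqxx ?orbT.
have [-> _] := genU cardF gen_zeta Min.
by rewrite mul_row3 /= a_inv /a_; apply: eq_row3; ring.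
Qed.

(** All generators of H are linear maps or sigma^3, hence commute with multiplication by beta +
    beta^-1, an element of F_8. That map [h] need not be unitary, so its centraliser is formed
    inside the group of all permutations and intersected with [GammaU]. *)
Lemma grpH_inH x : mvalid x -> mbar b x \in grpH zeta -> inH x.
Proof.
set h := perm_fun (fun v : 'rV[F]_3 => (b + b ^+ 8) *: v) => mx xH.
have hE v : h v = (b + b ^+ 8) *: v.
  by apply: perm_funE; apply/scalerI/(omega_neq0 cardF beta_prim).
pose C := 'C_(GammaU F)[h]%G.
have linC M : M \in [:: matA F; matB zeta; matC zeta; matD zeta; matE zeta; matF F] ->
    bar (linmap M) \in (C / scalars F)%g.
  move=> Min; have [ME GM] := genU cardF gen_zeta Min; apply: mem_quotient.
  rewrite inE GM; apply/cent1P/permP=> v.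
  by rewrite !permM !hE !ME scalemxAl.
have sigC : (bar (sigma F) ^+ 3)%g \in (C / scalars F)%g.
  have [sE sG] := sigmaU cardF.
  rewrite /bar -morphX ?(GammaU_norm sG) //; apply: mem_quotient.
  rewrite inE groupX //; apply/cent1P/permP=> v; rewrite !permM !hE !sE.
  apply/rowP=> j; rewrite !mxE -{1}(frob3_omega cardF beta_prim).
  by rewrite !frobS frob_id /rho -!exprM -exprMn.
have sH : grpH zeta \subset (C / scalars F)%g.
  rewrite gen_subG subUset !gen_subG; apply/andP; split; apply/subsetP=> g;
    by rewrite !in_setU !in_set1; do 5?[case/orP]; move/eqP-> => //; apply: linC;
       rewrite !inE eqxx ?orbT.
have /morphimP[g _ /setIP[Gg Cg] def_x] := subsetP sH _ xH.
exact: (mperm_omega cardF beta_prim mx Gg Cg (esym def_x)).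
Qed.

End Instance.

Local Open Scope group_scope.

Theorem theorem1p2 (F : finFieldType) (cardF : #|F| = 64)
    (zeta : {unit F}) (gen_zeta : generator [set: {unit F}] zeta) :
  let H := grpH zeta in
  let K := grpK zeta in
  let Delta := coset_adj K (grpK1 zeta) (grpK2 zeta) in
  let x1 : {set coset_of (scalars F)} := grpK1 zeta in
  let x2 : {set coset_of (scalars F)} := grpK2 zeta in
  let W1 := 'O_3(vker Delta H x1 1) in
  let W2 := 'O_3(vker Delta H x2 1) in
  let hatW1 := 'O_3(vker Delta K x1 1) in
  let hatW2 := 'O_3(vker Delta K x2 1) in
  [/\ [/\ Delta x1 x2, #|nbhd Delta x1| = 4 & #|nbhd Delta x2| = 3],
      [/\ 3.-abelem W1 /\ #|W1| = 9,
          [/\ special W2, #|W2| = 27 & exponent W2 = 3],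
          hatW1 \isog setX W1 (Zp 3)
        & hatW2 \isog setX W2 (Zp 3)]
    & [/\ [/\ nbhd_perms Delta H x1 \isog [set: 'S_4],
              isog_sdprod (vker Delta H x1 1) W1 (Zp 2),
              vker Delta H x1 2 \isog W1
            & vker Delta H x1 3 :=: 1],
          [/\ nbhd_perms Delta H x2 \isog [set: 'S_3],
              isog_sdprod (vker Delta H x2 1) W2 (Zp 2),
              [/\ vker Delta H x2 2 :=: vker Delta H x2 3,
                  vker Delta H x2 3 :=: 'Z(W2)
                & 'Z(W2) \isog Zp 3]
            & vker Delta H x2 4 :=: 1],
          [/\ nbhd_perms Delta K x1 \isog [set: 'S_4],
              isog_sdprod (vker Delta K x1 1) hatW1 (Zp 2),
              vker Delta K x1 2 \isog hatW1,
              [/\ vker Delta K x1 3 :=: vker Delta K x1 4,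
                  vker Delta K x1 4 :=: 'Z(vstab K x1)
                & 'Z(vstab K x1) \isog Zp 3]
            & vker Delta K x1 5 :=: 1]
        & [/\ nbhd_perms Delta K x2 \isog [set: 'S_3],
              isog_sdprod (vker Delta K x2 1) hatW2 (Zp 2),
              [/\ vker Delta K x2 2 :=: vker Delta K x2 3,
                  vker Delta K x2 3 :=: 'Z(hatW2)
                & 'Z(hatW2) \isog setX (Zp 3) (Zp 3)]
            & vker Delta K x2 4 :=: 1]]].
Proof.
have b_prim := beta_prim cardF gen_zeta.
have Min : matD zeta \in [:: matA F; matB zeta; matC zeta; matD zeta; matE zeta; matF F].
  by rewrite !inE eqxx ?orbT.
have [_ GD] := genU cardF gen_zeta Min.
have DE := linmap_matD_row3 cardF gen_zeta.
have eA := bar_matA cardF gen_zeta; have eB := bar_matB cardF gen_zeta.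
have eC := bar_matC cardF gen_zeta; have eE := bar_matE cardF gen_zeta.
have eF := bar_matF cardF gen_zeta; have eS := bar_sigma cardF gen_zeta.
(* The groups of the statement unfold to those generated in the abstract amalgam, so only the
   hypotheses on [phi] and the generators remain. *)
apply: (@amalgam_structure _ (mbar (beta zeta)) (bar (linmap (matA F)))
  (bar (linmap (matB zeta))) (bar (linmap (matC zeta))) (bar (linmap (matD zeta)))
  (bar (linmap (matE zeta))) (bar (linmap (matF F))) (bar (sigma F))) => //.
- exact: mbarM.
- exact: mbar_inj.
- by rewrite eF; apply: mbar_dd.
- by rewrite eA; apply: mbar_ad.
- by rewrite eB eA; apply: mbar_bd.
- by rewrite eS eF; apply: mbar_ds.
- by rewrite eC; apply: mbar_dcd.
- exact: mbar_d_notin.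
exact: grpH_inH.
Qed.
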